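(* Let $n,m\ge 2$ and $$d=\frac{n^2m^2}{2}-\frac{n^2}{2}-\frac{m^2}{2}-\frac{nm}{2}-\frac n2-\frac m2+2=\binom{nm}{2}-\binom n2-\binom m2-(n+m-2).$$ Then the Kronecker function $\kappa_{n,m,nm}$ is a piecewise quasipolynomial of degree at most $d$.
   Context: For partitions $\mu,\nu,\lambda$ of the same integer with $\ell(\mu)\le n$, $\ell(\nu)\le m$, $\ell(\lambda)\le nm$, the Kronecker coefficient $g_{\mu,\nu,\lambda}$ is defined by $s_\lambda(x_1y_1,x_1y_2,\dots,x_ny_m)=\sum_{\mu,\nu}g_{\mu,\nu,\lambda}\,s_\mu(x_1,\dots,x_n)s_\nu(y_1,\dots,y_m)$, with $s$ the Schur polynomials. The Kronecker function $\kappa_{n,m,nm}$ is the function $(\mu_1,\dots,\mu_n,\nu_1,\dots,\nu_m,\lambda_1,\dots,\lambda_{nm})\mapsto g_{\mu,\nu,\lambda}$ on such triples. A multivariate quasipolynomial is a function $g:\mathbb{Z}^N\to\mathbb{Q}$ for which there is a full-rank lattice $\Lambda\subseteq\mathbb{Z}^N$ and polynomials $p_i$, one for each coset $\lambda_i+\Lambda$, with $g=p_i$ on $\lambda_i+\Lambda$; its degree is the maximum degree of the $p_i$. A piecewise quasipolynomial is a function whose domain admits a finite decomposition into (polyhedral) pieces on each of which it agrees with a quasipolynomial. *)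

(* Defs.v *)
From HB Require Import structures.
From mathcomp Require Import all_boot all_order all_algebra.
Set Implicit Arguments. Unset Strict Implicit. Unset Printing Implicit Defensive.
Import Order.TTheory GRing.Theory Num.Theory.

Definition is_partition (K : nat) (lam : 'I_K -> nat) : bool :=
  [forall i : 'I_K, forall j : 'I_K, (i <= j)%N ==> (lam j <= lam i)%N].

Definition psize (K : nat) (lam : 'I_K -> nat) : nat := (\sum_(i < K) lam i)%N.

Definition in_shape (K S : nat) (lam : 'I_K -> nat) (x : 'I_K * 'I_S) : bool :=
  (x.2 < lam x.1)%N.
Arguments in_shape {K S} lam x.

(* Semistandard Young tableau of shape lam with entries in 'I_K (the totally
   ordered alphabet 0 < 1 < ... < K-1); non-cells are normalised to 0 so that
   each tableau is represented exactly once. *)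
Definition is_ssyt (K : nat) (lam : 'I_K -> nat)
    (T : {ffun 'I_K * 'I_(psize lam).+1 -> 'I_K}) : bool :=
  [forall x, ~~ in_shape lam x ==> (val (T x) == 0%N)] &&
  [forall x, forall y, (in_shape lam x && in_shape lam y) ==>
     ((((x.1 : nat) == y.1) && ((y.2 : nat) == (x.2).+1)) ==> (T x <= T y)%N) &&
     ((((x.2 : nat) == y.2) && ((y.1 : nat) == (x.1).+1)) ==> (T x < T y)%N)].
Arguments is_ssyt {K} lam T.

(* Kostka number: coefficient of x^alpha in the Schur polynomial
   s_lam(x_1, ..., x_K) (number of SSYT of shape lam and content alpha). *)
Definition kostka (K : nat) (lam : 'I_K -> nat) (alpha : 'I_K -> nat) : nat :=
  #|[set T : {ffun 'I_K * 'I_(psize lam).+1 -> 'I_K} | is_ssyt lam T &&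
      [forall i : 'I_K, #|[set c | in_shape lam c && (T c == i)]| == alpha i]]|.

(* Coefficient of x^a y^b in s_lam(x_1 y_1, x_1 y_2, ..., x_n y_m): the variable
   number e (0-based) of 'I_(n*m) is x_(e %/ m) y_(e %% m). *)
Definition sxy_coef (n m : nat) (lam : 'I_(n * m) -> nat)
    (a : 'I_n -> nat) (b : 'I_m -> nat) : nat :=
  #|[set T : {ffun 'I_(n * m) * 'I_(psize lam).+1 -> 'I_(n * m)} | is_ssyt lam T &&
      [forall i : 'I_n, #|[set c | in_shape lam c && (T c %/ m == i)%N]| == a i] &&
      [forall j : 'I_m, #|[set c | in_shape lam c && (T c %% m == j)%N]| == b j]]|.

Local Open Scope ring_scope.

(* g is the family of Kronecker coefficients g_{mu,nu,lam}: the identity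
   s_lam(x_i y_j) = sum_{mu,nu} g_{mu,nu,lam} s_mu(x) s_nu(y)
   holds coefficientwise for every partition lam with l(lam) <= nm, the sum
   ranging over partitions mu, nu of |lam| with l(mu) <= n, l(nu) <= m. *)
Definition is_kronecker (n m : nat)
    (g : {ffun 'I_n -> nat} -> {ffun 'I_m -> nat} -> {ffun 'I_(n * m) -> nat} -> rat)
    : Prop :=
  forall lam : {ffun 'I_(n * m) -> nat}, is_partition lam ->
  forall (a : 'I_n -> nat) (b : 'I_m -> nat),
    (sxy_coef lam a b)%:R =
    \sum_(mu : {ffun 'I_n -> 'I_(psize lam).+1} |
           is_partition (fun i => val (mu i)) &&
           (psize (fun i => val (mu i)) == psize lam))
    \sum_(nu : {ffun 'I_m -> 'I_(psize lam).+1} |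
           is_partition (fun j => val (nu j)) &&
           (psize (fun j => val (nu j)) == psize lam))
      g [ffun i => val (mu i)] [ffun j => val (nu j)] lam
        * (kostka (fun i => val (mu i)) a)%:R
        * (kostka (fun j => val (nu j)) b)%:R.

Definition kN (n m : nat) : nat := (n + m + n * m)%N.

Definition cmu (n m : nat) (i : 'I_n) : 'I_(kN n m) := lshift (n * m) (lshift m i).
Definition cnu (n m : nat) (j : 'I_m) : 'I_(kN n m) := lshift (n * m) (rshift n j).
Definition clam (n m : nat) (k : 'I_(n * m)) : 'I_(kN n m) := rshift (n + m) k.
Arguments cmu : clear implicits.
Arguments cnu : clear implicits.
Arguments clam : clear implicits.

Definition kron_domain (n m : nat) (x : 'cV[int]_(kN n m)) : Prop :=
  (forall k, 0 <= x k 0) /\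
  is_partition (fun i => `|x (cmu n m i) ord0|%N) /\
  is_partition (fun j => `|x (cnu n m j) ord0|%N) /\
  is_partition (fun k => `|x (clam n m k) ord0|%N) /\
  psize (fun i => `|x (cmu n m i) ord0|%N) = psize (fun k => `|x (clam n m k) ord0|%N) /\
  psize (fun j => `|x (cnu n m j) ord0|%N) = psize (fun k => `|x (clam n m k) ord0|%N).

Arguments kron_domain : clear implicits.

Definition kron_fun (n m : nat)
    (g : {ffun 'I_n -> nat} -> {ffun 'I_m -> nat} -> {ffun 'I_(n * m) -> nat} -> rat)
    (x : 'cV[int]_(kN n m)) : rat :=
  g [ffun i => `|x (cmu n m i) ord0|%N] [ffun j => `|x (cnu n m j) ord0|%N]
    [ffun k => `|x (clam n m k) ord0|%N].

(* A polynomial in N variables with rational coefficients, as a list of terms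
   (coefficient, exponent vector). *)
Definition mpoly (N : nat) := seq (rat * {ffun 'I_N -> nat}).

Definition mp_eval (N : nat) (p : mpoly N) (x : 'cV[int]_N) : rat :=
  \sum_(t <- p) t.1 * \prod_(i < N) ((x i 0)%:~R ^+ t.2 i).

Definition mp_deg_le (N : nat) (p : mpoly N) (d : nat) : bool :=
  all (fun t : rat * {ffun 'I_N -> nat} => (\sum_(i < N) t.2 i <= d)%N) p.

(* q : Z^N -> Q is a quasipolynomial of degree <= d: there is a full-rank
   lattice Lambda = B Z^N (det B <> 0) and a polynomial of degree <= d on each
   coset of Lambda with which q agrees on that coset. *)
Definition quasipoly_deg_le (N : nat) (q : 'cV[int]_N -> rat) (d : nat) : Prop :=
  exists B : 'M[int]_N, \det B != 0 /\
  exists P : 'cV[int]_N -> mpoly N,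
    (forall x y : 'cV[int]_N, (exists z : 'cV[int]_N, x - y = B *m z) -> P x = P y) /\
    (forall x, mp_deg_le (P x) d) /\
    (forall x, q x = mp_eval (P x) x).

Definition in_piece (N : nat) (P : seq ('rV[int]_N * int)) (x : 'cV[int]_N) : bool :=
  all (fun h => (h.1 *m x) 0 0 <= h.2) P.

Definition piecewise_quasipoly_deg_le (N : nat) (D : 'cV[int]_N -> Prop)
    (f : 'cV[int]_N -> rat) (d : nat) : Prop :=
  exists pieces : seq (seq ('rV[int]_N * int)),
    (forall x, D x -> exists2 P, P \in pieces & in_piece P x) /\
    (forall P, P \in pieces ->
       exists q : 'cV[int]_N -> rat, quasipoly_deg_le q d /\
         (forall x, D x -> in_piece P x -> f x = q x)).

(* Main.v *)
(* Multiplying the defining identity of the Kronecker coefficients by the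
   Vandermonde products in x and in y turns its right-hand side into a sum of
   products of alternants, in which g_(mu,nu,lam) is the coefficient of
   x^(mu+delta) y^(nu+delta).  The Vandermonde product in the variables x_i y_j is,
   up to a monomial, the one in x times the one in y times the product of
   C(nm,2) - C(n,2) - C(m,2) binomials, so the bialternant formula expresses that
   sum as the quotient of the alternant of lam in the x_i y_j by these binomials.
   On coefficient functions, dividing by a binomial X^a - X^b is summing along the
   direction a - b, which maps piecewise quasipolynomials of degree d to degree
   d + 1.  The binomials contain n + m - 2 linearly independent directions
   spanning all others; dividing by those first only produces indicator functions
   of polyhedra, of degree 0, so the degree is the number of remaining binomials. *)

Require Import Defs.
From HB Require Import structures.
From mathcomp Require Import all_boot all_order all_algebra.
From mathcomp Require Import all_fingroup mpoly ring zify.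
Set Implicit Arguments. Unset Strict Implicit. Unset Printing Implicit Defensive.
Import Order.TTheory GRing.Theory Num.Theory.
Local Open Scope ring_scope.

(** * Piecewise quasipolynomials *)

(** No quotient is formed. A difference operator has many inverses, so the iterated line sums and
    the coefficient function are compared in a class where inversion is unique: functions vanishing
    wherever a fixed linear functional lies below a bound, all directions lowering that functional.
    The number [e = m i + j] of the variable [x_i y_j] is linear in its exponent, so this functional
    is negative on the direction of every pair [e < f]. It also truncates each infinite line sum to
    an affine number of terms. Cutting such sums by half-spaces rounds the endpoints, which is where
    polynomials turn into quasipolynomials. The Vandermonde product in [x] is found on the pairs
    involving [y_0], the one in [y] on those involving [x_0]. The independent directions [x_0 - x_k]
    and [y_0 - y_l] must come from other binomials, namely those at [y_1] and [x_1], which exist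
    since [n, m >= 2]. Their coordinate functions are integral, so no congruence enters the
    indicator functions. The coordinates of [lam] are parameters that no direction moves; all
    regions are cut out jointly in [mu], [nu] and [lam]. *)

Lemma poly_antidifference (p : {poly rat}) :
  exists2 q : {poly rat}, (size q <= (size p).+1)%N & forall t, q.[t + 1] - q.[t] = p.[t].
Proof.
have [k] := ubnP (size p); elim: k p => // k IH p; rewrite ltnS => sp.
have [->|p0] := eqVneq p 0.
  by exists 0 => [|t]; rewrite ?size_poly0 // !horner0 subrr.
have sp0 : (0 < size p)%N by rewrite size_poly_gt0.
set j := (size p).-1; have Ej : size p = j.+1 by rewrite prednK.
(* The difference of [X^(j+1)] has leading term [(j+1) X^j]; this multiple cancels the leading term
   of [p], and what remains has smaller size. *)
pose c := lead_coef p / j.+1%:R.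
pose q0 : {poly rat} := c *: 'X^(j.+1).
pose d0 : {poly rat} := c *: (('X + 1) ^+ j.+1 - 'X^(j.+1)).
have d0E t : q0.[t + 1] - q0.[t] = d0.[t].
  by rewrite !(hornerE, horner_exp) -mulrBr.
have cE : c * j.+1%:R = lead_coef p by rewrite /c divfK // pnatr_eq0.
have sd : (size (p - d0)%R < size p)%N.
  rewrite Ej ltnS; apply/leq_sizeP => i ji.
  rewrite /d0 coefB coefZ coefB coefXn exprDn coef_sum.
  under eq_bigr => l _ do rewrite expr1n mulr1 coefMn coefXn.
  move: ji; rewrite leq_eqVlt => /orP[/eqP <-|ji].
    rewrite (bigD1 (inord 1)) //= inordK // big1; last first.
      move=> l /eqP Hl; case: eqP => [E|]; last by rewrite mul0rn.
      by case: Hl; apply: val_inj; rewrite /= inordK //; have := ltn_ord l; lia.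
    rewrite subSS subn0 eqxx bin1 addr0 (ltn_eqF (ltnSn j)) subr0.
    by rewrite cE lead_coefE Ej subrr.
  have -> : p`_i = 0 by rewrite nth_default // Ej.
  rewrite (bigD1 ord0) //= subn0 bin0 mulr1n big1 ?addr0 ?subrr ?mulr0 ?subr0 //.
  move=> l /eqP Hl; case: eqP => [E|]; last by rewrite mul0rn.
  case: Hl; apply: val_inj; have := ltn_ord l; rewrite /=; lia.
have [q1 sq1 q1E] := IH _ (leq_trans sd sp).
exists (q0 + q1) => [|t].
  rewrite (leq_trans (size_polyD _ _)) // geq_max; apply/andP; split.
    by rewrite (leq_trans (size_scale_leq _ _)) // size_polyXn Ej.
  by apply: leq_trans sq1 _; rewrite ltnS ltnW.
have /(congr1 (+%R^~ d0.[t])) := q1E t.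
rewrite [(p - d0).[t]]hornerD hornerN subrK -d0E => <-.
rewrite !hornerD; ring.
Qed.

(* [(k + (M - 1 - r)) %/ M] is the ceiling of [(k - r) / M]. *)
Lemma ceil_div_step (k r : int) (M : nat) : (0 < M)%N ->
  (((k + 1 + (M%:Z - 1 - r)) %/ M%:Z)%Z =
   ((k + (M%:Z - 1 - r)) %/ M%:Z)%Z + ((k - r) %% M%:Z == 0)%Z%:R)
  /\ ((k == r %[mod M])%Z -> k = r + M%:Z * ((k + (M%:Z - 1 - r)) %/ M%:Z)%Z).
Proof.
move=> M0.
have M0' : M%:Z != 0 by case: M M0.
have E : k = ((k - r) %/ M%:Z)%Z * M%:Z + ((k - r) %% M%:Z)%Z + r.
  by rewrite -divz_eq subrK.
have := modz_ge0 (k - r) M0'; have := @ltz_pmod (k - r) M%:Z M0.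
set a := ((k - r) %/ M%:Z)%Z in E *; set s := ((k - r) %% M%:Z)%Z in E * => s1 s0.
have -> : k + 1 + (M%:Z - 1 - r) = (a + 1) * M%:Z + s by rewrite {1}E; ring.
have -> : k + (M%:Z - 1 - r) = (a + 1) * M%:Z + (s - 1) by rewrite {1}E; ring.
rewrite !divzMDl //.
have -> : (s %/ M)%Z = 0 by apply: divz_small; rewrite s0.
have [s00|sn0] := eqVneq s 0.
  have -> : ((s - 1) %/ M)%Z = -1.
    have -> : s - 1 = -1 * M%:Z + (M%:Z - 1) by rewrite s00; ring.
    by rewrite divzMDl // divz_small ?addr0 //; lia.
  by split => [|_]; [rewrite addr0 /= subrK | rewrite {1}E s00; ring].
have -> : ((s - 1) %/ M)%Z = 0 by apply: divz_small; lia.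
split; first by rewrite mulr0n !addr0.
by rewrite eqz_mod_dvd => /dvdz_mod0P /eqP; rewrite -/s (negbTE sn0).
Qed.

(** For [b < a] the value is 0, not the signed reversed sum: cutting the interval by a half-line
    then only replaces an endpoint by a minimum or a maximum. *)
Definition zsum (a b : int) (F : int -> rat) : rat :=
  if a <= b then \sum_(0 <= t < `|b - a|%N) F (a + t%:Z) else 0.

Lemma zsum_geq a b F : b <= a -> zsum a b F = 0.
Proof.
rewrite /zsum => ba; case: ifP => // ab.
have -> : a = b by lia.
by rewrite subrr big_geq.
Qed.

Lemma zsum_telescope a b F (S : int -> rat) : a <= b ->
  (forall k, S (k + 1) - S k = F k) -> zsum a b F = S b - S a.
Proof.
move=> ab ES; rewrite /zsum ab.
under eq_bigr => t _ do rewrite -ES -addrA -PoszD addn1.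
rewrite (telescope_sumr (fun t : nat => S (a + t%:Z))) //.
by rewrite addr0; congr (S _ - _); lia.
Qed.

Lemma eq_zsum a b F G : (forall k, a <= k < b -> F k = G k) -> zsum a b F = zsum a b G.
Proof.
move=> E; rewrite /zsum; case: ifP => // ab; rewrite !big_nat.
by apply: eq_bigr => t /andP[_ lt_t]; apply: E; lia.
Qed.

Lemma zsum_cat b a c F : a <= b -> b <= c -> zsum a c F = zsum a b F + zsum b c F.
Proof.
move=> ab bc; rewrite /zsum ab bc (le_trans ab bc).
rewrite (@big_cat_nat _ _ _ `|b - a|%N) //=; last by lia.
congr (_ + _); rewrite -{1}[`|b - a|%N]add0n big_addn.
have -> : (`|c - a| - `|b - a| = `|c - b|)%N by lia.
by apply: eq_bigr => t _; congr F; lia.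
Qed.

Lemma zsum_lt a b c F : zsum a b (fun k => (k < c)%R%:R * F k) = zsum a (Num.min b c) F.
Proof.
have [bc|cb] := leP b c.
  by apply: eq_zsum => k kab; have -> : k < c by [lia|]; rewrite mul1r.
have [ca|ac] := leP c a.
  rewrite (zsum_geq _ ca) (@eq_zsum _ _ _ (fun=> 0)) => [|k kab].
    by rewrite /zsum; case: ifP => // _; rewrite big1.
  have -> : k < c = false by lia.
  by rewrite mul0r.
rewrite (zsum_cat (b := c)) ?(ltW ac) ?(ltW cb) // [X in _ + X](_ : _ = 0).
  by rewrite addr0; apply: eq_zsum => k kab; have -> : k < c by [lia|]; rewrite mul1r.
rewrite (@eq_zsum _ _ _ (fun=> 0)) => [|k kab].
  by rewrite /zsum; case: ifP => // _; rewrite big1.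
have -> : k < c = false by lia.
by rewrite mul0r.
Qed.

Lemma zsum_ge a b c F : zsum a b (fun k => (c <= k)%R%:R * F k) = zsum (Num.max a c) b F.
Proof.
have [ac|ca] := leP a c; last first.
  by apply: eq_zsum => k kab; have -> : c <= k by [lia|]; rewrite mul1r.
have [bc|cb] := leP b c.
  rewrite (zsum_geq _ bc) (@eq_zsum _ _ _ (fun=> 0)) => [|k kab].
    by rewrite /zsum; case: ifP => // _; rewrite big1.
  have -> : c <= k = false by lia.
  by rewrite mul0r.
rewrite (zsum_cat (b := c)) ?ac ?(ltW cb) // [X in X + _](_ : _ = 0).
  by rewrite add0r; apply: eq_zsum => k kab; have -> : c <= k by [lia|]; rewrite mul1r.
rewrite (@eq_zsum _ _ _ (fun=> 0)) => [|k kab].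
  by rewrite /zsum; case: ifP => // _; rewrite big1.
have -> : c <= k = false by lia.
by rewrite mul0r.
Qed.

(** * Quasipolynomials and their discrete summation *)

Section Quasipolynomials.
Variable N : nat.
Implicit Types (x y z v : 'cV[int]_N) (f g : 'cV[int]_N -> rat).

(** Generators instead of lattices and cosets: closure under products, translations and summation
    becomes plain induction. The index is an upper bound on the degree, and only [qpoly_coordM]
    forces it to grow. *)
Inductive qpoly : nat -> ('cV[int]_N -> rat) -> Prop :=
| qpoly_periodic d (M : nat) chi :
    (0 < M)%N -> (forall x z, chi (x + z *+ M) = chi x) -> qpoly d chi
| qpoly_coordM d e i f :
    (d < e)%N -> qpoly d f -> qpoly e (fun x => (x i 0)%:~R * f x)
| qpoly_add d f g : qpoly d f -> qpoly d g -> qpoly d (fun x => f x + g x)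
| qpoly_ext d f g : f =1 g -> qpoly d f -> qpoly d g.

Lemma qpoly_cst d c : qpoly d (fun _ => c).
Proof. exact: (@qpoly_periodic d 1). Qed.

Lemma qpoly_le d e f : (d <= e)%N -> qpoly d f -> qpoly e f.
Proof.
move=> de qf; elim: qf e de => {d f}.
- by move=> d M chi M0 H e _; apply: qpoly_periodic M0 H.
- by move=> d d' i f lt_d qf IH e le_d; apply: qpoly_coordM qf; apply: leq_trans le_d.
- by move=> d f g _ IHf _ IHg e le; apply: qpoly_add; [apply: IHf | apply: IHg].
- by move=> d f g E _ IH e le; apply: qpoly_ext E (IH _ le).
Qed.

Lemma qpoly_periodicM d M chi f : (0 < M)%N -> (forall x z, chi (x + z *+ M) = chi x) ->
  qpoly d f -> qpoly d (fun x => chi x * f x).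
Proof.
move=> M0 Hchi; elim=> {d f}.
- move=> d M' chi' M'0 H'; apply: (@qpoly_periodic _ (M * M')) => [|x z].
    by rewrite muln_gt0 M0.
  by rewrite mulrnA H' -mulrnA mulnC mulrnA Hchi.
- move=> d d' i f lt_d qf IH.
  apply: qpoly_ext (qpoly_coordM i lt_d IH) => x; exact: mulrCA.
- move=> d f g _ IHf _ IHg; apply: qpoly_ext (qpoly_add IHf IHg) => x.
  by rewrite mulrDr.
- by move=> d f g E _ IH; apply: qpoly_ext IH => x; rewrite E.
Qed.

Lemma qpoly_mul d e f g : qpoly d f -> qpoly e g -> qpoly (d + e) (fun x => f x * g x).
Proof.
move=> qf qg; elim: qf => {d f}.
- move=> d M chi M0 H; apply: qpoly_periodicM M0 H _.
  by apply: qpoly_le qg; apply: leq_addl.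
- move=> d d' i f lt_d qf IH.
  apply: (@qpoly_ext _ (fun x => (x i 0)%:~R * (f x * g x))) => [x|].
    by rewrite mulrA.
  by apply: qpoly_coordM IH; rewrite ltn_add2r.
- move=> d f f' _ IHf _ IHf'; apply: qpoly_ext (qpoly_add IHf IHf') => x.
  by rewrite mulrDl.
- by move=> d f f' E _ IH; apply: qpoly_ext IH => x; rewrite E.
Qed.

Lemma qpoly_scale d c f : qpoly d f -> qpoly d (fun x => c * f x).
Proof. by move=> qf; apply: (qpoly_mul (qpoly_cst 0 c)). Qed.

Lemma qpoly_sub d f g : qpoly d f -> qpoly d g -> qpoly d (fun x => f x - g x).
Proof.
move=> qf qg; apply: qpoly_ext (qpoly_add qf (qpoly_scale (-1) qg)) => x.
by rewrite mulN1r.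
Qed.

Lemma qpoly_sum d (I : Type) (r : seq I) (F : I -> 'cV[int]_N -> rat) :
  (forall i, qpoly d (F i)) -> qpoly d (fun x => \sum_(i <- r) F i x).
Proof.
move=> H; elim: r => [|i r IH].
  by apply: qpoly_ext (qpoly_cst d 0) => x; rewrite big_nil.
by apply: qpoly_ext (qpoly_add (H i) IH) => x; rewrite big_cons.
Qed.

Lemma qpoly_translate d v f : qpoly d f -> qpoly d (fun x => f (x + v)).
Proof.
elim=> {d f}.
- move=> d M chi M0 H; apply: (@qpoly_periodic _ M) => // x z.
  by rewrite addrAC H.
- move=> d d' i f lt_d _ IH.
  have H1 : qpoly d' (fun x => (x i 0)%:~R * f (x + v)) by apply: qpoly_coordM IH.
  have H2 : qpoly d' (fun x => (v i 0)%:~R * f (x + v)).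
    by apply: qpoly_scale; apply: qpoly_le IH; apply: ltnW.
  apply: qpoly_ext (qpoly_add H1 H2) => x.
  by rewrite mxE intrD mulrDl.
- by move=> d f g _ IHf _ IHg; apply: qpoly_add IHf IHg.
- by move=> d f g E _ IH; apply: qpoly_ext IH => x; rewrite E.
Qed.

Definition aff (a : 'rV[int]_N * int) x : int := (a.1 *m x) 0 0 + a.2.

Lemma affD a x v : aff a (x + v) = aff a x + (a.1 *m v) 0 0.
Proof. by rewrite /aff mulmxDr mxE addrAC. Qed.

Lemma qpoly_aff d a : qpoly d.+1 (fun x => (aff a x)%:~R).
Proof.
have H : qpoly d.+1 (fun x => \sum_(i < N) (a.1 0 i)%:~R * ((x i 0)%:~R * 1)).
  apply: qpoly_sum => i; apply: qpoly_scale.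
  by apply: (@qpoly_coordM 0) => //; apply: qpoly_cst.
apply: qpoly_ext (qpoly_add H (qpoly_cst d.+1 (a.2)%:~R)) => x.
rewrite /aff mxE intrD rmorph_sum; congr (_ + _); apply: eq_bigr => i _.
by rewrite mulr1 rmorphM.
Qed.

(* A bound [(a, b)] stands for the function [floor (a x / b.+1)]. *)
Definition bound := ('rV[int]_N * int * nat)%type.
Definition flo (b : bound) x : int := (aff b.1 x %/ b.2.+1%:Z)%Z.

(** The floor is the affine form minus its remainder, over the denominator, and the remainder is
    periodic. This is the source of nonconstant periodic coefficients. *)
Lemma qpoly_flo d b : qpoly d.+1 (fun x => (flo b x)%:~R).
Proof.
case: b => a b; rewrite /flo /=.
have H : qpoly d.+1 (fun x => ((aff a x %% b.+1%:Z)%Z)%:~R : rat).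
  apply: (@qpoly_periodic _ b.+1) => // x z; congr (_%:~R).
  rewrite affD -scaler_nat -scalemxAr mxE.
  by rewrite addrC [_%:R * _]mulrC natz modzMDl.
have := qpoly_scale (b.+1%:R^-1) (qpoly_sub (qpoly_aff d a) H).
apply: qpoly_ext => x.
rewrite {1}(divz_eq (aff a x) b.+1%:Z) intrD addrK intrM.
by rewrite mulrC mulfK // pnatr_eq0.
Qed.

Lemma qpoly_horner d (p : {poly rat}) f :
  (size p <= d.+1)%N -> qpoly 1 f -> qpoly d (fun x => p.[f x]).
Proof.
move=> sp qf.
have Hexp j : qpoly j (fun x => f x ^+ j).
  elim: j => [|j IH]; first exact: qpoly_cst.
  by apply: qpoly_ext (qpoly_mul qf IH) => x; rewrite exprS.
have H : qpoly d (fun x => \sum_(i < d.+1) p`_i * f x ^+ i).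
  by apply: qpoly_sum => i; apply/qpoly_scale/(qpoly_le _ (Hexp i)); rewrite -ltnS.
by apply: qpoly_ext H => x; rewrite (horner_coef_wide _ sp).
Qed.

(** Nested floors with positive denominators collapse into one. The stored denominator is one less
    than the true one, hence the [.-1] in the witness. *)
Lemma flo_div b (M : nat) (c : int) : (0 < M)%N ->
  exists b' : bound, forall x, flo b' x = ((flo b x + c) %/ M%:Z)%Z.
Proof.
case: b => [a b] M0.
exists (a.1, a.2 + c * b.+1%:Z, (b.+1 * M).-1) => x.
rewrite /flo /aff /= prednK ?muln_gt0 // PoszM divzMA_ge0 // addrA.
by rewrite [_ + c * _]addrC divzMDl // [c + _]addrC.
Qed.

(** The factor [k ^+ j] makes the induction work: at [x + k v] a coordinate equals [x_i + k v_i], so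
    removing a coordinate factor from [f] trades degree in [x] for a power of [k]. Floors can
    replace [k] because they have degree 1. *)
Lemma qpoly_antidifference d f v : qpoly d f -> forall j : nat,
  exists S : 'cV[int]_N -> int -> rat,
    (forall x k, S x (k + 1) - S x k = k%:~R ^+ j * f (x + k *: v)) /\
    (forall b, qpoly (d + j).+1 (fun x => S x (flo b x))).
Proof.
elim=> {d f}.
- move=> d M chi M0 Hchi j.
  (* On the class [k = r + M t] the periodic factor does not depend on [t], and [k ^+ j] is a
     polynomial in [t]. *)
  have HP (r : 'I_M) : exists q : {poly rat}, (size q <= j.+2)%N /\
      forall t, q.[t + 1] - q.[t] = (r%:R + M%:R * t) ^+ j.
    have [q sq qE] := poly_antidifference ((r%:R%:P + M%:R *: 'X) ^+ j).
    exists q; split => [|t]; last by rewrite qE !(hornerE, horner_exp).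
    apply: leq_trans sq _; rewrite ltnS (leq_trans (size_poly_exp_leq _ _)) //.
    rewrite ltnS -[leqRHS]mul1n leq_mul2r; apply/orP; right.
    rewrite -subn1 leq_subLR.
    rewrite (leq_trans (size_polyD _ _)) // geq_max size_polyC.
    rewrite (leq_trans (size_scale_leq _ _)) ?size_polyX // andbT.
    by case: (_ != 0).
  have [Psi HPsi] := fin_all_exists HP.
  pose ceil (k : int) (r : 'I_M) := ((k + (M%:Z - 1 - r%:Z)) %/ M%:Z)%Z.
  (* [ceil k r] is the least [t] with [k <= r + M t]; from [k] to [k + 1] it changes only for the
     class [r] of [k]. *)
  exists (fun x k => \sum_(r < M) chi (x + r%:Z *: v) * (Psi r).[(ceil k r)%:~R]).
  split => [x k|b].
    have M0' : M%:Z != 0 by case: M M0 {HP Psi HPsi ceil Hchi}.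
    have kM : (`|(k %% M%:Z)%Z| < M)%N.
      have := modz_ge0 k M0'; have := @ltz_pmod k M%:Z M0; lia.
    pose r0 : 'I_M := Ordinal kM.
    have r0E : r0%:Z = (k %% M%:Z)%Z by rewrite /= gez0_abs // modz_ge0.
    rewrite -sumrB (bigD1 r0) //= [X in _ + X]big1 ?addr0 => [|r rr0]; last first.
      have [E _] := ceil_div_step k r M0; rewrite -mulrBr /ceil E.
      case: eqP => [|_]; last by rewrite addr0 subrr mulr0.
      move/dvdz_mod0P; rewrite -eqz_mod_dvd => /eqP kr; case/eqP: rr0.
      apply: val_inj => /=; rewrite kr modz_small //=.
      by rewrite ltz_nat ltn_ord.
    have kr0 : (k == r0 %[mod M])%Z by rewrite r0E modz_mod.
    have [E1 E2] := ceil_div_step k r0 M0; move/(_ kr0) in E2.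
    move: kr0; rewrite eqz_mod_dvd => /dvdz_mod0P kr0.
    rewrite -mulrBr /ceil E1 kr0 intrD (HPsi r0).2 mulrC.
    rewrite {3}E2 intrD intrM; congr (_ * _).
    have -> : k *: v = r0%:Z *: v + ((k %/ M%:Z)%Z *: v) *+ M.
      rewrite {1}(divz_eq k M) r0E scalerDl addrC; congr (_ + _).
      by rewrite -scaler_nat scalerA natz mulrC.
    by rewrite addrA Hchi.
  apply: qpoly_sum => r.
  apply: (@qpoly_periodicM _ M (fun x => chi (x + r%:Z *: v))) => // [x z|].
    by rewrite addrAC Hchi.
  have [b' b'E] := flo_div b (M%:Z - 1 - r%:Z) M0.
  apply: (@qpoly_ext _ (fun x => (Psi r).[(flo b' x)%:~R])) => [x|].
    by rewrite b'E.
  apply: qpoly_horner; last exact: qpoly_flo.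
  by apply: leq_trans (HPsi r).1 _; rewrite !ltnS leq_addl.
- move=> d d' i f lt_d _ IH j.
  have [S1 [E1 q1]] := IH j; have [S2 [E2 q2]] := IH j.+1.
  exists (fun x k => (x i 0)%:~R * S1 x k + (v i 0)%:~R * S2 x k); split => [x k|b].
    rewrite opprD addrACA -!mulrBr E1 E2 !mxE intrD intrM exprS; ring.
  apply: qpoly_add.
    by apply: qpoly_coordM (q1 b); rewrite ltnS ltn_add2r.
  by apply/qpoly_scale/(qpoly_le _ (q2 b)); rewrite ltnS addnS ltn_add2r.
- move=> d f g _ IHf _ IHg j.
  have [S1 [E1 q1]] := IHf j; have [S2 [E2 q2]] := IHg j.
  exists (fun x k => S1 x k + S2 x k); split => [x k|b].
    by rewrite opprD addrACA E1 E2 mulrDr.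
  exact: qpoly_add.
- move=> d f g E _ IH j; have [S [ES qS]] := IH j.
  by exists S; split => // x k; rewrite ES E.
Qed.

(** * Piecewise quasipolynomials and their sums along a line *)

Definition hs_neg (h : 'rV[int]_N * int) := (- h.1, - h.2 - 1).

Lemma hs_negP h x : ((hs_neg h).1 *m x) 0 0 <= (hs_neg h).2 = ~~ ((h.1 *m x) 0 0 <= h.2).
Proof.
rewrite /hs_neg /= mulNmx [X in X <= _]mxE; set u : int := (h.1 *m x) 0 0; lia.
Qed.

(** A sum of quasipolynomials restricted to polyhedra that may overlap, so that addition needs no
    common refinement. Pieces on which one quasipolynomial holds are recovered only in
    [pqpoly_piecewise]. *)
Inductive pqpoly d : ('cV[int]_N -> rat) -> Prop :=
| pqpoly0 f : f =1 (fun=> 0) -> pqpoly d f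
| pqpoly_cell P q f g : qpoly d q -> pqpoly d f ->
    (forall x, g x = (in_piece P x)%:R * q x + f x) -> pqpoly d g.

Lemma pqpoly_ext d f g : f =1 g -> pqpoly d f -> pqpoly d g.
Proof.
move=> E pf; case: pf E => {f} [f E0 E|P q f f' qq pf Ef' E].
  by apply: pqpoly0 => x; rewrite -E E0.
by apply: (pqpoly_cell qq pf (P := P)) => x; rewrite -E Ef'.
Qed.

Lemma pqpoly_qpoly d P q : qpoly d q -> pqpoly d (fun x => (in_piece P x)%:R * q x).
Proof.
move=> qq; apply: (pqpoly_cell (P := P) qq (@pqpoly0 d (fun=> 0) _)) => // x.
by rewrite addr0.
Qed.

Lemma pqpoly_add d f g : pqpoly d f -> pqpoly d g -> pqpoly d (fun x => f x + g x).
Proof.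
move=> pf pg; elim: pf => {f} [f E0|P q f f' qq pf IH E].
  by apply: pqpoly_ext pg => x; rewrite E0 add0r.
by apply: (pqpoly_cell (P := P) qq IH) => x; rewrite E addrA.
Qed.

Lemma pqpoly_sum d (I : Type) (r : seq I) (F : I -> 'cV[int]_N -> rat) :
  (forall i, pqpoly d (F i)) -> pqpoly d (fun x => \sum_(i <- r) F i x).
Proof.
move=> H; elim: r => [|i r IH]; first by apply: pqpoly0 => x; rewrite big_nil.
by apply: pqpoly_ext (pqpoly_add (H i) IH) => x; rewrite big_cons.
Qed.

Lemma pqpoly_restrict d P f : pqpoly d f -> pqpoly d (fun x => (in_piece P x)%:R * f x).
Proof.
elim=> {f} [f E0|P' q f f' qq pf IH E].
  by apply: pqpoly0 => x; rewrite E0 mulr0.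
apply: (pqpoly_cell (P := P ++ P') qq IH) => x.
by rewrite E mulrDr mulrA /in_piece all_cat -natrM mulnb.
Qed.

Lemma pqpoly_if d (h : 'rV[int]_N * int) f g : pqpoly d f -> pqpoly d g ->
  pqpoly d (fun x => if (h.1 *m x) 0 0 <= h.2 then f x else g x).
Proof.
move=> /(pqpoly_restrict [:: h]) pf /(pqpoly_restrict [:: hs_neg h]) pg.
apply: pqpoly_ext (pqpoly_add pf pg) => x.
rewrite /in_piece /= !andbT hs_negP.
by case: ifP => _; rewrite mul1r mul0r ?addr0 ?add0r.
Qed.

Lemma in_piece_translate (P : seq ('rV[int]_N * int)) v :
  exists P' : seq ('rV[int]_N * int), forall x, in_piece P (x + v) = in_piece P' x.
Proof.
exists [seq (h.1, h.2 - (h.1 *m v) 0 0) | h <- P] => x.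
rewrite /in_piece all_map; apply: eq_all => h /=.
by rewrite mulmxDr mxE lerBrDr.
Qed.

Lemma pqpoly_translate d v f : pqpoly d f -> pqpoly d (fun x => f (x + v)).
Proof.
elim=> {f} [f E0|P q f f' qq pf IH E]; first by apply: pqpoly0 => x.
have [P' P'E] := in_piece_translate P v.
apply: (pqpoly_cell (P := P') (qpoly_translate v qq) IH) => x.
by rewrite E P'E.
Qed.

(** Cross-multiplication turns the comparison of the unrounded quotients into a half-space, and
    floors are monotone. The two floors may still agree on the side where the quotients compare
    strictly. *)
Lemma flo_compare (b c : bound) : exists h : 'rV[int]_N * int, forall x,
  if (h.1 *m x) 0 0 <= h.2 then flo b x <= flo c x else flo c x <= flo b x.
Proof.
case: b c => [a b] [a' c].
exists (c.+1%:Z *: a.1 - b.+1%:Z *: a'.1, b.+1%:Z * a'.2 - c.+1%:Z * a.2) => x.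
have -> : flo (a, b) x = ((c.+1%:Z * aff a x) %/ (c.+1%:Z * b.+1%:Z))%Z.
  by rewrite divzMpl.
have -> : flo (a', c) x = ((b.+1%:Z * aff a' x) %/ (c.+1%:Z * b.+1%:Z))%Z.
  by rewrite [c.+1%:Z * _]mulrC divzMpl.
rewrite /= mulmxBl -!scalemxAl [X in X <= _]mxE [X in _ + X]mxE.
rewrite [X in X - _]mxE [X in _ - X]mxE /aff.
set u : int := (a.1 *m x) 0 0; set w : int := (a'.1 *m x) 0 0.
by case: ifP => H; apply: lez_pdiv2r => //; lia.
Qed.

(** Induction on the inequalities of [P]. On the line, an inequality bounds [k] below, above, or not
    at all, by the sign of its slope [hv]; it moves one endpoint to another floor or becomes a
    condition on [x]. With no inequality left, the sum telescopes where the endpoints are in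
    order. *)
Lemma pqpoly_line_cell d q v P (b c : bound) : qpoly d q ->
  pqpoly d.+1 (fun x => zsum (flo b x) (flo c x)
    (fun k => (in_piece P (x + k *: v))%:R * q (x + k *: v))).
Proof.
move=> qq; elim: P b c => [|h P IH] b c.
  have [S [ES qS]] := qpoly_antidifference v qq 0.
  have [h hP] := flo_compare b c.
  have qd : qpoly d.+1 (fun x => S x (flo c x) - S x (flo b x)).
    by rewrite -[d]addn0; apply: qpoly_sub; apply: qS.
  apply: pqpoly_ext (pqpoly_qpoly [:: h] qd) => x.
  have := hP x; rewrite {1}/in_piece /= andbT; case: ifP => _ H.
    by rewrite mul1r (zsum_telescope H (S := S x)).
  by rewrite mul0r zsum_geq.
pose hv := (h.1 *m v) 0 0.
have hE x k : (h.1 *m (x + k *: v)) 0 0 = (h.1 *m x) 0 0 + k * hv.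
  by rewrite mulmxDr mxE -scalemxAr [X in _ + X]mxE.
pose F x k := (in_piece P (x + k *: v))%:R * q (x + k *: v).
have FE x k : (in_piece (h :: P) (x + k *: v))%:R * q (x + k *: v) =
    ((h.1 *m x) 0 0 + k * hv <= h.2)%R%:R * F x k.
  by rewrite /F mulrA -natrM mulnb -hE.
have [hv0|hv0|hv0] := ltgtP hv 0.
- (* k >= ceil ((h x - c) / - hv) *)
  pose l : bound := (h.1, - h.2 + (- hv - 1), `|hv|.-1).
  have hvE : (`|hv|.-1.+1)%:Z = - hv by lia.
  have lP x k : (h.1 *m x) 0 0 + k * hv <= h.2 = (flo l x <= k).
    rewrite /flo /aff /= hvE -ltzD1 -[_ < _]negbK -leNgt lez_divRL; last by lia.
    by rewrite -ltNge; lia.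
  have [e eP] := flo_compare b l.
  apply: pqpoly_ext (pqpoly_if e (IH l c) (IH b c)) => x.
  rewrite [RHS](@eq_zsum _ _ _ (fun k => (flo l x <= k)%R%:R * F x k)) => [|k _].
    rewrite [RHS]zsum_ge; have := eP x; case: ifP => _ H.
      by rewrite /= max_r.
    by rewrite /= max_l.
  by rewrite FE lP.
- (* k < floor ((c - h x) / hv) + 1 *)
  pose l : bound := (- h.1, h.2 + hv, `|hv|.-1).
  have hvE : (`|hv|.-1.+1)%:Z = hv by lia.
  have lP x k : (h.1 *m x) 0 0 + k * hv <= h.2 = (k < flo l x).
    rewrite /flo /aff /= hvE mulNmx [X in X + (h.2 + hv)]mxE -lezD1 lez_divRL; last by lia.
    set u : int := (h.1 *m x) 0 0.
    by lia.
  have [e eP] := flo_compare c l.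
  apply: pqpoly_ext (pqpoly_if e (IH b c) (IH b l)) => x.
  rewrite [RHS](@eq_zsum _ _ _ (fun k => (k < flo l x)%R%:R * F x k)) => [|k _].
    rewrite [RHS]zsum_lt; have := eP x; case: ifP => _ H.
      by rewrite /= min_l.
    by rewrite /= min_r.
  by rewrite FE lP.
- apply: pqpoly_ext (pqpoly_restrict [:: h] (IH b c)) => x.
  rewrite {1}/in_piece /= andbT /zsum; case: ifP => _; last by rewrite mulr0.
  rewrite mulr_sumr; apply: eq_bigr => t _.
  by rewrite FE hv0 mulr0 addr0.
Qed.

Lemma pqpoly_line_sum d v (a : 'rV[int]_N * int) f : pqpoly d f ->
  pqpoly d.+1 (fun x => zsum 0 (aff a x) (fun k => f (x + k *: v))).
Proof.
elim=> {f} [f E0|P q f f' qq pf IH E].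
  apply: pqpoly0 => x; rewrite /zsum; case: ifP => // _.
  by rewrite big1.
(* These bounds denote the constant 0 and the form [a] itself, over denominator 1. *)
have := pqpoly_line_cell v P (0, 0, 0%N) (a, 0%N) qq.
move/(pqpoly_add IH); apply: pqpoly_ext => x.
rewrite /flo !divz1 {2}/aff /= mul0mx mxE addr0 /zsum; case: ifP => _.
  by rewrite -big_split; apply: eq_bigr => t _ /=; rewrite E addrC.
by rewrite addr0.
Qed.

(** * From the inductive classes back to lattices, cosets and pieces *)

Lemma qpoly_periodic_coefs d f : qpoly d f -> exists (M : nat) (P : 'cV[int]_N -> Defs.mpoly N),
  [/\ (0 < M)%N, forall x z, P (x + z *+ M) = P x, forall x, mp_deg_le (P x) d
    & forall x, f x = mp_eval (P x) x].
Proof.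
elim=> {d f}.
- move=> d M chi M0 H; exists M, (fun x => [:: (chi x, [ffun=> 0%N])]); split=> //.
  + by move=> x z; rewrite H.
  + by move=> x; rewrite /mp_deg_le /= andbT big1 // => i _; rewrite ffunE.
  + move=> x; rewrite /mp_eval big_seq1 /= big1 ?mulr1 // => i _.
    by rewrite ffunE expr0.
- move=> d e i f de _ [M [P [M0 HP dP EP]]].
  pose up (t : rat * {ffun 'I_N -> nat}) :=
    (t.1, [ffun k => ((k == i) + t.2 k)%N] : {ffun 'I_N -> nat}).
  exists M, (fun x => [seq up t | t <- P x]); split=> //.
  + by move=> x z; rewrite HP.
  + move=> x; rewrite /mp_deg_le all_map; apply: sub_all (dP x) => t /= td.
    rewrite (eq_bigr (fun k => (k == i) + t.2 k)%N); last by move=> k _; rewrite ffunE.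
    rewrite big_split /= (bigD1 i) //= eqxx big1 => [|k /negbTE ->] //.
    by rewrite addn0 add1n (leq_ltn_trans td).
  + move=> x; rewrite EP /mp_eval big_map mulr_sumr; apply: eq_bigr => t _ /=.
    rewrite mulrCA; congr (_ * _); rewrite [RHS](eq_bigr (fun k =>
      (x k 0)%:~R ^+ (k == i) * (x k 0)%:~R ^+ t.2 k)) => [|k _]; last first.
      by rewrite /= ffunE exprD.
    rewrite big_split /=; congr (_ * _).
    by rewrite (bigD1 i) //= eqxx big1 ?mulr1 // => k /negbTE ->.
- move=> d f g _ [M [P [M0 HP dP EP]]] _ [M' [P' [M'0 HP' dP' EP']]].
  exists (M * M')%N, (fun x => P x ++ P' x); split=> [|x z|x|x].
  + by rewrite muln_gt0 M0.
  + by rewrite {2}mulrnA HP' mulnC mulrnA HP.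
  + by rewrite /mp_deg_le all_cat; apply/andP; split; [apply: dP | apply: dP'].
  + by rewrite /mp_eval big_cat EP EP'.
- move=> d f g E _ [M [P [M0 HP dP EP]]].
  by exists M, P; split=> // x; rewrite -E EP.
Qed.

Lemma qpoly_quasipoly d f : qpoly d f -> quasipoly_deg_le f d.
Proof.
move=> /qpoly_periodic_coefs [M [P [M0 HP dP EP]]].
exists (M%:Z%:M); split.
  by rewrite det_scalar expf_neq0 //; case: M M0 {HP}.
exists P; split; last by split.
move=> x y [z xy]; have -> : x = y + z *+ M; last exact: HP.
by rewrite -[LHS](subrK y) xy mul_scalar_mx -natz scaler_nat addrC.
Qed.

(** A new cell [P] refines each piece [P'] into the part inside [P], where [q] is added, and for
    every inequality of [P] the part violating it, where nothing changes. The latter parts may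
    overlap, harmlessly since they carry the same quasipolynomial. *)
Lemma pqpoly_piecewise d (D : 'cV[int]_N -> Prop) f g : pqpoly d f ->
  (forall x, D x -> g x = f x) -> piecewise_quasipoly_deg_le D g d.
Proof.
move=> pf Eg.
suff [ps [cov Hps]] : exists ps : seq (seq ('rV[int]_N * int)),
    (forall x, exists2 P, P \in ps & in_piece P x) /\
    (forall P, P \in ps -> exists q, qpoly d q /\ forall x, in_piece P x -> f x = q x).
  exists ps; split=> [x _|P /Hps[q [qq Eq]]]; first exact: cov.
  exists q; split; first exact: qpoly_quasipoly.
  by move=> x Dx Px; rewrite Eg // Eq.
elim: pf => {f g Eg} [f E|P q f f' qq _ [ps [cov Hps]] E].
  exists [:: [::]]; split=> [x|P]; first by exists [::]; rewrite ?mem_head.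
  by rewrite inE => _; exists (fun=> 0); split=> //; apply: qpoly_cst.
exists ([seq P ++ P' | P' <- ps] ++ [seq hs_neg h :: P' | h <- P, P' <- ps]).
split=> [x|Q].
  have [P' P'ps xP'] := cov x.
  have [xP|/allPn[h hP xh]] := boolP (in_piece P x).
    exists (P ++ P'); last by rewrite /in_piece all_cat; apply/andP.
    by rewrite mem_cat map_f.
  exists (hs_neg h :: P'); last by rewrite /in_piece /= hs_negP xh.
  by rewrite mem_cat; apply/orP; right; apply/allpairsP; exists (h, P').
rewrite mem_cat => /orP[/mapP[P' /Hps[q' [qq' Eq']] ->]|].
  exists (fun x => q x + q' x); split; first exact: qpoly_add.
  move=> x; rewrite /in_piece all_cat => /andP[xP xP'].
  by rewrite E /in_piece xP mul1r Eq'.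
case/allpairsP=> -[h P'] [/= hP /Hps[q' [qq' Eq']] ->].
exists q'; split=> // x; rewrite /in_piece /= hs_negP => /andP[xh xP'].
rewrite E (_ : in_piece P x = false) ?mul0r ?add0r ?Eq' //.
by apply/negP => /allP /(_ _ hP); apply/negP.
Qed.

End Quasipolynomials.

(** * The bialternant formula *)

Lemma card_ord_lt (S c : nat) : (c <= S)%N -> #|[pred i : 'I_S | (i < c)%N]| = c.
Proof. by move=> cS; rewrite -sum1_card (big_ord_narrow cS) sum1_card card_ord. Qed.

(** Used on the rows of a tableau: the entries below a given letter form an initial segment, which
    is recovered from their number. *)
Lemma initial_segment_card (S : nat) (P : pred 'I_S) :
  (forall c c' : 'I_S, c' = c.+1 :> nat -> P c' -> P c) ->
  forall c, P c = (c < #|P|)%N.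
Proof.
move=> HP.
have down i (c c' : 'I_S) : c' = (c + i)%N :> nat -> P c' -> P c.
  elim: i c' => [|i IH] c' E Pc'.
    by have -> : c = c' by apply: ord_inj; rewrite E addn0.
  have ciS : (c + i < S)%N by have := ltn_ord c'; lia.
  apply: (IH (Ordinal ciS)) => //; apply: HP Pc' => /=; lia.
move=> c; apply/idP/idP => [Pc|].
  rewrite -(card_ord_lt (ltn_ord c)); apply/subset_leq_card/subsetP => i.
  rewrite inE ltnS => ic; apply: (down (c - i)%N) Pc; lia.
apply: contraLR => nPc; rewrite -leqNgt -[leqRHS](card_ord_lt (ltnW (ltn_ord c))).
apply/subset_leq_card/subsetP => i Pi; rewrite inE ltnNge.
apply: contra nPc => ci; apply: (down (i - c)%N) Pi; lia.
Qed.

Lemma geometric_telescope (R : comNzRingType) (x y : R) (a b e : nat) : (a <= b.+1)%N ->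
  x ^+ (b.+1 + e) - x ^+ (a + e) * y ^+ (b.+1 - a) =
  (x - y) * \sum_(a <= t < b.+1) x ^+ (t + e) * y ^+ (b - t).
Proof.
move=> ab; rewrite mulr_sumr big_nat.
rewrite (eq_bigr (fun t => x ^+ (t.+1 + e) * y ^+ (b.+1 - t.+1) -
                           x ^+ (t + e) * y ^+ (b.+1 - t))); last first.
  move=> t /andP[_ tb]; rewrite subSS subSn // addSn !exprS; ring.
rewrite -big_nat (telescope_sumr (fun t => x ^+ (t + e) * y ^+ (b.+1 - t)))//.
by rewrite subnn expr0 mulr1.
Qed.

Lemma sum_ord_range (V : nmodType) (S a b : nat) (F : nat -> V) : (b < S)%N ->
  \sum_(t < S | (a <= t <= b)%N) F t = \sum_(a <= t < b.+1) F t.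
Proof.
move=> bS; rewrite -(big_mkord (fun t => (a <= t <= b)%N) F).
rewrite [RHS](big_nat_widen _ _ S) // [RHS](big_nat_widenl _ 0) //.
by apply: eq_bigl => t; rewrite ltnS andbC.
Qed.

(** * Alternants and their branching rule *)

Section Bialternant.
Variables (R : comNzRingType) (z : nat -> R).

Definition alternant (k : nat) (l : nat -> nat) : R :=
  \det (\matrix_(j < k, i < k) z i ^+ l j).

Definition vandermonde_prod (k : nat) : R := \prod_(j < k) \prod_(i < j) (z i - z j).

Definition pad (k S : nat) (mu : {ffun 'I_k -> 'I_S}) (i : nat) : nat :=
  if insub i is Some j then mu j : nat else 0%N.

Lemma padE k S (mu : {ffun 'I_k -> 'I_S}) (j : 'I_k) : pad mu j = mu j.
Proof. by rewrite /pad valK. Qed.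

Lemma pad_out k S (mu : {ffun 'I_k -> 'I_S}) i : (k <= i)%N -> pad mu i = 0%N.
Proof. by move=> ki; rewrite /pad insubF // ltnNge ki. Qed.

(** For [lam] with at most [k.+1] parts, this says that [lam / mu] is a horizontal strip. *)
Definition interlace k S (lam : nat -> nat) (mu : {ffun 'I_k -> 'I_S}) : bool :=
  [forall j : 'I_k, (lam j.+1 <= mu j <= lam j)%N].

(** The exponents [lam + delta], with [delta = (k-1, ..., 1, 0)]. *)
Definition shifted k (lam : nat -> nat) (j : nat) : nat := (lam j + (k - j.+1))%N.

(** Alternants obey the branching rule of Schur polynomials up to the factors [z i - z k], exactly
    those by which the Vandermonde product grows with the variable [z k]. *)
Lemma alternant_branching k S (lam : nat -> nat) :
  (forall i, lam i.+1 <= lam i)%N -> (lam 0 < S)%N ->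
  alternant k.+1 (shifted k.+1 lam) = (\prod_(i < k) (z i - z k)) *
    (z k ^+ lam k * \sum_(mu : {ffun 'I_k -> 'I_S} | interlace lam mu)
      (\prod_(j < k) z k ^+ (lam j - mu j)) * alternant k (shifted k (pad mu))).
Proof.
move=> lam_dec lamS.
have lam_le i : (lam i <= lam 0)%N by elim: i => // i; apply: leq_trans.
set l := shifted k.+1 lam.
pose A : 'M[R]_k.+1 := \matrix_(j, i) z i ^+ l j.
(* Subtracting a multiple of row j.+1 from row j clears the last column above
   the last row. *)
pose U : 'M[R]_k.+1 := \matrix_(j, i)
  ((i == j)%:R - (i == j.+1 :> nat)%:R * z k ^+ (l j - l j.+1)).
have detU : \det U = 1.
  rewrite -det_tr det_trig; last first.
    apply/is_trig_mxP => i j ij; rewrite !mxE.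
    have -> : (i == j) = false by apply/negbTE; rewrite -val_eqE /= neq_ltn ij.
    have -> : (i == j.+1 :> nat) = false by lia.
    by rewrite mul0r subr0.
  rewrite big1 // => i _; rewrite !mxE eqxx.
  have -> : (i == i.+1 :> nat) = false by lia.
  by rewrite mul0r subr0.
have UA (j i : 'I_k.+1) : (U *m A) j i =
    z i ^+ l j - (j < k)%N%:R * (z i ^+ l j.+1 * z k ^+ (l j - l j.+1)).
  rewrite mxE; under eq_bigr => s _ do rewrite !mxE mulrBl.
  rewrite sumrB (bigD1 j) //= eqxx mul1r big1 ?addr0; last first.
    by move=> s /negbTE ->; rewrite mul0r.
  congr (_ - _); have [jk|kj] := ltnP j k.
    rewrite (bigD1 (Ordinal (jk : (j.+1 < k.+1)%N))) //= eqxx !mul1r big1 ?addr0.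
      by rewrite mulrC.
    move=> s sj; have -> : (s == j.+1 :> nat) = false; last by rewrite !mul0r.
    by apply/negbTE; apply: contra sj => /eqP sj; apply/eqP/val_inj.
  rewrite big1 ?mul0r // => s _.
  have -> : (s == j.+1 :> nat) = false by have := ltn_ord s; lia.
  by rewrite !mul0r.
have -> : alternant k.+1 l = \det (U *m A) by rewrite det_mulmx detU mul1r.
rewrite (expand_det_col _ ord_max) (bigD1 ord_max) //= big1 ?addr0; last first.
  move=> j jk; have {}jk : (j < k)%N.
    by rewrite ltn_neqAle -ltnS ltn_ord andbT; apply: contra jk => /eqP jk; apply/eqP/val_inj.
  rewrite UA jk mul1r /= -exprD subnKC ?subrr ?mul0r //.
  by rewrite /l /shifted; have := lam_dec j; lia.
rewrite UA /= ltnn mul0r subr0 /cofactor addnn -signr_odd odd_double mul1r.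
have -> : l k = lam k by rewrite /l /shifted; lia.
(* Each entry left after the row operation is a geometric difference; dividing column [i] by
   [z i - z k] leaves this sum. *)
pose c (j i : 'I_k) := \sum_(t < S | (lam j.+1 <= t <= lam j)%N)
  z k ^+ (lam j - t) * z i ^+ (t + (k - j.+1)).
have -> : row' ord_max (col' ord_max (U *m A)) =
    (\matrix_(j, i) c j i) *m diag_mx (\row_(i < k) (z i - z k)).
  apply/matrixP => j i; rewrite [LHS]mxE [LHS]mxE UA mul_mx_diag !mxE.
  rewrite !lift_max ltn_ord mul1r /c.
  have -> : l j = ((lam j).+1 + (k - j.+1))%N by rewrite /l /shifted; have := ltn_ord j; lia.
  have -> : l j.+1 = (lam j.+1 + (k - j.+1))%N by rewrite /l /shifted; have := ltn_ord j; lia.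
  rewrite subnDr geometric_telescope; last by apply: leqW.
  rewrite mulrC; congr (_ * _).
  rewrite -(@sum_ord_range _ S _ _ (fun t => _ * _)); last exact: leq_ltn_trans lamS.
  by apply: eq_bigr => t _; rewrite mulrC.
rewrite det_mulmx det_diag [\det _ * _]mulrC mulrCA.
have -> : \prod_(i < k) (\row_i0 (z i0 - z k)) 0 i = \prod_(i < k) (z i - z k).
  by apply: eq_bigr => i _; rewrite mxE.
congr (_ * (_ * _)).
rewrite /determinant.
(* By multilinearity in the rows, choosing one summand [t] per row amounts to choosing an
   interlacing [mu]. *)
transitivity (\sum_(s : 'S_k) \sum_(mu : {ffun 'I_k -> 'I_S} | interlace lam mu)
   (\prod_(j < k) z k ^+ (lam j - mu j)) *
   ((-1) ^+ s * \prod_(j < k) z (s j) ^+ (mu j + (k - j.+1)))).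
  apply: eq_bigr => s _; under eq_bigr => j _ do rewrite mxE /c.
  rewrite (bigA_distr_big_dep _ _) mulr_sumr; apply: eq_big => mu.
    by apply/familyP/forallP.
  by move=> _; rewrite mulrCA; congr (_ * _); rewrite -big_split.
rewrite exchange_big; apply: eq_bigr => mu _ /=.
rewrite -mulr_sumr; congr (_ * _); apply: eq_bigr => s _; congr (_ * _).
by apply: eq_bigr => j _; rewrite mxE /shifted padE.
Qed.

(** * Tableaux and the branching rule for Schur polynomials *)

Section Tableaux.
Variables (K S : nat).
Local Notation cellT := ('I_K.+1 * 'I_S.+1)%type.
Local Notation tabT := {ffun cellT -> 'I_K.+1}.
Implicit Types (lam : nat -> nat) (x y : cellT) (T : tabT).

Definition cell lam x : bool := (x.2 < lam x.1)%N.

(** Unlike in [is_ssyt], the size [k] of the alphabet is a number and the type of fillings is fixed,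
    so that an induction can remove letters. *)
Definition ssyt (lam : nat -> nat) (k : nat) (T : tabT) : bool :=
  [&& [forall x, ~~ cell lam x ==> (val (T x) == 0%N)],
      [forall x, forall y, (cell lam x && cell lam y) ==>
         ((((x.1 : nat) == y.1) && ((y.2 : nat) == (x.2).+1)) ==> (T x <= T y)%N) &&
         ((((x.2 : nat) == y.2) && ((y.1 : nat) == (x.1).+1)) ==> (T x < T y)%N)]
    & [forall x, cell lam x ==> (T x < k)%N]].

Lemma ssytP lam k T : reflect
  [/\ forall x, ~~ cell lam x -> T x = ord0,
      forall x y, cell lam x -> cell lam y -> x.1 = y.1 -> y.2 = x.2.+1 :> nat ->
        (T x <= T y)%N,
      forall x y, cell lam x -> cell lam y -> x.2 = y.2 -> y.1 = x.1.+1 :> nat ->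
        (T x < T y)%N
    & forall x, cell lam x -> (T x < k)%N] (ssyt lam k T).
Proof.
apply: (iffP and3P).
  case=> /forallP H1 /forallP H2 /forallP H3; split.
  - by move=> x nx; apply/val_inj/eqP; apply: (implyP (H1 x)).
  - move=> x y cx cy xy1 xy2; have /forallP/(_ y) := H2 x; rewrite cx cy /=.
    by rewrite xy1 xy2 !eqxx /= => /andP[].
  - move=> x y cx cy xy1 xy2; have /forallP/(_ y) := H2 x; rewrite cx cy /=.
    by rewrite xy1 xy2 !eqxx /= => /andP[].
  - by move=> x; apply/implyP.
case=> H1 H2 H3 H4; split; apply/forallP => x.
- by apply/implyP => /H1 ->.
- apply/forallP => y; apply/implyP => /andP[cx cy]; apply/andP; split.
    by apply/implyP => /andP[/eqP/ord_inj xy1 /eqP xy2]; apply: H2.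
  by apply/implyP => /andP[/eqP/ord_inj xy1 /eqP xy2]; apply: H3.
- by apply/implyP => /H4.
Qed.

Definition schur_sum lam k : R :=
  \sum_(T | ssyt lam k T) \prod_(x | cell lam x) z (T x).

Lemma ssyt_row_le lam k T : (forall i, lam i.+1 <= lam i)%N ->
  ssyt lam k T -> forall x, cell lam x -> (x.1 <= T x)%N.
Proof.
move=> dec /ssytP[_ _ Hcol _] [[i iK] c]; elim: i iK => // i IH iK cx /=.
have iK' := ltnW iK.
have cx' : cell lam (Ordinal iK', c) by apply: leq_trans cx (dec _).
apply: leq_ltn_trans (IH iK' cx') _; exact: Hcol.
Qed.

Section Branching.
Variables (k : nat) (lam : nat -> nat).
Hypotheses (kK : (k < K.+1)%N) (dec : forall i, (lam i.+1 <= lam i)%N).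
Hypotheses (lam_S : (lam 0 <= S)%N) (lam_k : lam k.+1 = 0%N).

Local Notation mu_t := {ffun 'I_k -> 'I_S.+1}.
Implicit Types mu : mu_t.

Lemma lam_le i : (lam i <= S)%N.
Proof. by apply: leq_trans lam_S; elim: i => // i; apply: leq_trans. Qed.

Lemma lam_out i : (k < i)%N -> lam i = 0%N.
Proof.
elim: i => // i IH; rewrite ltnS leq_eqVlt => /orP[/eqP <- //|/IH E].
by have := dec i; rewrite E leqn0 => /eqP.
Qed.

Definition row_of (j : 'I_k) : 'I_K.+1 := widen_ord (ltnW kK) j.

Definition small_part (T : tabT) : mu_t :=
  [ffun j => inord #|[pred c : 'I_S.+1 | cell lam (row_of j, c) & (T (row_of j, c) < k)%N]|].

Definition extend_tab (mu : mu_t) (T : tabT) : tabT :=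
  [ffun x => if cell (pad mu) x then T x else if cell lam x then inord k else ord0].

Definition restrict_tab (mu : mu_t) (T : tabT) : tabT :=
  [ffun x => if cell (pad mu) x then T x else ord0].

(** The letters below [k] fill an initial segment of each row, and by strictness of the columns none
    of them occurs in row [k] or later. *)
Lemma small_partP T x : ssyt lam k.+1 T ->
  cell (pad (small_part T)) x = cell lam x && (T x < k)%N.
Proof.
move=> Tss; have [_ Hrow _ Hk] := ssytP _ _ _ Tss.
case: x => r c; have [rk|kr] := ltnP r k; last first.
  rewrite /cell pad_out //= ltn0; apply/esym/negbTE/negP => /andP[cx].
  by rewrite ltnNge (leq_trans kr (ssyt_row_le dec Tss (x := (r, c)) cx)).
have -> : r = row_of (Ordinal rk) by apply: ord_inj.
set j := Ordinal rk; rewrite {1}/cell /= (padE _ j) ffunE inordK.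
  rewrite -(@initial_segment_card _ [pred c | cell lam (row_of j, c) & (T (row_of j, c) < k)%N]) //.
  move=> c1 c2 c12 /= /andP[cell2 Tk].
  have cell1 : cell lam (row_of j, c1).
    by apply: leq_trans cell2; rewrite /= c12 ltnS.
  by rewrite cell1 /=; apply: leq_ltn_trans Tk; apply: Hrow.
rewrite ltnS; apply: leq_trans (lam_le (row_of j)).
rewrite -[leqRHS](@card_ord_lt S.+1); last exact/leqW/lam_le.
by apply/subset_leq_card/subsetP => c1; rewrite !inE => /andP[].
Qed.

Lemma cell_pad mu x : interlace lam mu -> cell (pad mu) x -> cell lam x.
Proof.
move=> /forallP H; rewrite /cell; have [rk|kr] := ltnP x.1 k; last by rewrite pad_out.
by rewrite (padE mu (Ordinal rk)) => /leq_trans; apply; case/andP: (H (Ordinal rk)).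
Qed.

Lemma pad_dec mu : interlace lam mu -> forall i, (pad mu i.+1 <= pad mu i)%N.
Proof.
move=> /forallP H i; have [rk|kr] := ltnP i.+1 k; last by rewrite pad_out.
rewrite (padE mu (Ordinal rk)) (padE mu (Ordinal (ltnW rk))).
case/andP: (H (Ordinal rk)) => _ /leq_trans; apply.
by case/andP: (H (Ordinal (ltnW rk))).
Qed.

(** A horizontal strip has no two cells in one column; this keeps columns strict when the strip is
    filled with the single letter [k]. *)
Lemma cell_below mu x y : interlace lam mu -> cell lam y -> x.2 = y.2 ->
  y.1 = x.1.+1 :> nat -> cell (pad mu) x.
Proof.
move=> /forallP H cy xy2 xy1; have rk : (x.1 < k)%N.
  rewrite ltnNge; apply/negP => kx; move: cy; rewrite /cell lam_out ?ltn0 //.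
  by rewrite xy1 ltnS.
rewrite /cell (padE mu (Ordinal rk)) xy2; apply: leq_trans cy _.
by rewrite xy1; case/andP: (H (Ordinal rk)).
Qed.

Lemma small_part_interlace T : ssyt lam k.+1 T -> interlace lam (small_part T).
Proof.
move=> Tss; have [_ _ Hcol Hk] := ssytP _ _ _ Tss.
apply/forallP => j; rewrite -padE; apply/andP; split; rewrite leqNgt; apply/negP => lt.
  have jK : (j.+1 < K.+1)%N by apply: leq_ltn_trans kK.
  have cS : (pad (small_part T) j < S.+1)%N.
    by rewrite ltnS; apply: leq_trans (ltnW lt) (lam_le _).
  pose c := Ordinal cS.
  have cy : cell lam (Ordinal jK, c) by [].
  have cx : cell lam (row_of j, c) by apply: leq_trans cy (dec _).
  have Tk : (T (row_of j, c) < k)%N.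
    rewrite -ltnS; apply: leq_trans (Hk _ cy); rewrite ltnS; exact: Hcol.
  have := small_partP (row_of j, c) Tss; rewrite cx Tk /cell /=.
  by rewrite ltnn.
have cS : (lam j < S.+1)%N by rewrite ltnS lam_le.
have := small_partP (row_of j, Ordinal cS) Tss; rewrite /cell /= lt ltnn.
by [].
Qed.

Lemma extend_tab_ssyt mu T : interlace lam mu -> ssyt (pad mu) k T ->
  ssyt lam k.+1 (extend_tab mu T) /\ small_part (extend_tab mu T) = mu.
Proof.
move=> Hmu /ssytP[H0 Hrow Hcol Hk].
have Hk' : (inord k : 'I_K.+1) = k :> nat by rewrite inordK.
have ss : ssyt lam k.+1 (extend_tab mu T).
  apply/ssytP; split.
  - move=> x nx; rewrite ffunE (negbTE nx); case: ifP => // /(cell_pad Hmu).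
    by rewrite (negbTE nx).
  - move=> x y cx cy xy1 xy2; rewrite !ffunE cx cy.
    have [my|nmy] := boolP (cell (pad mu) y).
      have mx : cell (pad mu) x.
        by move: my; rewrite /cell xy1 xy2; apply: leq_trans.
      by rewrite mx; apply: Hrow.
    by rewrite Hk'; case: ifP => [/Hk/ltnW//|_]; rewrite Hk'.
  - move=> x y cx cy xy2 xy1; rewrite !ffunE cx cy (cell_below Hmu cy xy2 xy1).
    case: ifP => [my|_]; last by rewrite Hk' Hk // (cell_below Hmu cy xy2 xy1).
    by apply: Hcol => //; apply: cell_below xy2 xy1.
  - move=> x cx; rewrite ffunE cx; case: ifP => [/Hk/leqW//|_].
    by rewrite Hk'.
split=> //; apply/ffunP => j; apply: ord_inj; apply/eqP.
have E c : (c < small_part (extend_tab mu T) j)%N = (c < mu j)%N.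
  have [cS|Sc] := ltnP c S.+1; last first.
    by rewrite !ltnNge !(leq_trans _ Sc) // ltnW.
  have := small_partP (row_of j, Ordinal cS) ss.
  rewrite {1}/cell /= !padE => ->.
  rewrite ffunE; have -> : cell (pad mu) (row_of j, Ordinal cS) = (c < mu j)%N.
    by rewrite /cell /= padE.
  case: ifP => [mx|nmx].
    have mx' : cell (pad mu) (row_of j, Ordinal cS) by rewrite /cell /= padE.
    by rewrite (cell_pad Hmu mx') Hk.
  by case: ifP => //= _; rewrite Hk' ltnn.
by rewrite eqn_leq; apply/andP; split; rewrite leqNgt;
  [rewrite E | rewrite -E]; rewrite ltnn.
Qed.

Lemma restrict_tab_ssyt T : ssyt lam k.+1 T ->
  ssyt (pad (small_part T)) k (restrict_tab (small_part T) T).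
Proof.
move=> Tss; have [H0 Hrow Hcol Hk] := ssytP _ _ _ Tss.
have cE x := small_partP x Tss.
apply/ssytP; split.
- by move=> x nx; rewrite ffunE (negbTE nx).
- move=> x y cx cy; rewrite !ffunE cx cy; move: cx cy; rewrite !cE.
  by move=> /andP[cx _] /andP[cy _]; apply: Hrow.
- move=> x y cx cy; rewrite !ffunE cx cy; move: cx cy; rewrite !cE.
  by move=> /andP[cx _] /andP[cy _]; apply: Hcol.
- by move=> x cx; rewrite ffunE cx; move: cx; rewrite cE => /andP[].
Qed.

Lemma extend_restrict T : ssyt lam k.+1 T ->
  extend_tab (small_part T) (restrict_tab (small_part T) T) = T.
Proof.
move=> Tss; have [H0 Hrow Hcol Hk] := ssytP _ _ _ Tss.
apply/ffunP => x; rewrite !ffunE (small_partP x Tss).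
have [cx|nx] := boolP (cell lam x); last by rewrite H0.
case: (ltnP (T x) k) => //= kT; apply: ord_inj; rewrite inordK //.
by apply/eqP; rewrite eqn_leq kT /= -ltnS Hk.
Qed.

Lemma restrict_extend mu T : ssyt (pad mu) k T -> restrict_tab mu (extend_tab mu T) = T.
Proof.
move=> /ssytP[H0 _ _ _]; apply/ffunP => x; rewrite !ffunE.
by have [|nx] := boolP (cell (pad mu) x); rewrite //= H0.
Qed.

Lemma extend_tab_weight mu T : interlace lam mu ->
  \prod_(x | cell lam x) z (extend_tab mu T x) =
  z k ^+ lam k * (\prod_(j < k) z k ^+ (lam j - mu j)) * \prod_(x | cell (pad mu) x) z (T x).
Proof.
move=> Hmu; rewrite (bigID (cell (pad mu))) mulrC /=; congr (_ * _).
  apply: eq_big => x; last by case/andP=> _ mx; rewrite ffunE mx.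
  by apply: andb_idl; apply: cell_pad.
rewrite (eq_bigr (fun=> z k)); last first.
  by move=> x /andP[cx nmx]; rewrite ffunE cx (negbTE nmx) inordK.
have -> : \prod_(x | cell lam x && ~~ cell (pad mu) x) z k =
    \prod_(r < K.+1) z k ^+ (lam r - pad mu r).
  rewrite -(pair_big_dep xpredT (fun (r : 'I_K.+1) (c : 'I_S.+1) =>
     cell lam (r, c) && ~~ cell (pad mu) (r, c)) (fun _ _ => z k)) /=.
  apply: eq_bigr => r _; rewrite prodr_const; congr (_ ^+ _).
  have le : (pad mu r <= lam r)%N.
    rewrite leqNgt; apply/negP => lt.
    have cS : (lam r < S.+1)%N by rewrite ltnS lam_le.
    by have := @cell_pad mu (r, Ordinal cS) Hmu lt; rewrite /cell /= ltnn.
  rewrite -(@card_ord_lt S.+1 (lam r)); last exact/leqW/lam_le.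
  rewrite -(cardID [pred c : 'I_S.+1 | (c < pad mu r)%N] [pred c : 'I_S.+1 | (c < lam r)%N]).
  rewrite (@eq_card _ [predI _ & _] [pred c : 'I_S.+1 | (c < pad mu r)%N]); last first.
    by move=> c; rewrite !inE; apply: andb_idl => /leq_trans; apply.
  rewrite card_ord_lt; last by apply: leq_trans le _; apply/leqW/lam_le.
  by rewrite addKn; apply: eq_card => c; rewrite !inE /cell andbC.
rewrite (bigID (fun r : 'I_K.+1 => (r < k.+1)%N)) /= [X in _ * X]big1 ?mulr1; last first.
  by move=> r; rewrite -leqNgt => kr; rewrite lam_out // sub0n.
rewrite -(big_ord_widen _ (fun r => z k ^+ (lam r - pad mu r))) // big_ord_recr mulrC /=.
rewrite pad_out // subn0; congr (_ * _); apply: eq_bigr => j _.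
by rewrite padE.
Qed.

(** Erasing the letter [k] is a bijection onto pairs of an interlacing [mu] and a tableau of shape
    [mu] in the smaller alphabet. *)
Lemma schur_sum_branching : schur_sum lam k.+1 = z k ^+ lam k *
  \sum_(mu : mu_t | interlace lam mu)
      (\prod_(j < k) z k ^+ (lam j - mu j)) * schur_sum (pad mu) k.
Proof.
rewrite /schur_sum (partition_big small_part (interlace lam)) /=; last first.
  exact: small_part_interlace.
rewrite mulr_sumr; apply: eq_bigr => mu Hmu.
rewrite (reindex_onto (extend_tab mu) (restrict_tab mu)) /=; last first.
  by move=> T /andP[Tss /eqP <-]; apply: extend_restrict.
rewrite mulrA mulr_sumr; apply: eq_big => T.
  apply/idP/idP => [/andP[/andP[Tss /eqP E] /eqP E']|Tss].
    by rewrite -E' -[in ssyt _ _]E; rewrite -{2}E; apply: restrict_tab_ssyt.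
  have [ss ->] := extend_tab_ssyt Hmu Tss.
  by rewrite ss eqxx restrict_extend // eqxx.
by move=> _; rewrite extend_tab_weight.
Qed.

End Branching.

(** Both sides satisfy the same recursion in [k]; for [k = 0] only the empty tableau and the empty
    determinant remain. *)
Lemma schur_sum_alternant k lam : (k <= K.+1)%N ->
  (forall i, lam i.+1 <= lam i)%N -> (lam 0 <= S)%N -> lam k = 0%N ->
  vandermonde_prod k * schur_sum lam k = alternant k (shifted k lam).
Proof.
elim: k lam => [|k IH] lam kK dec lamS lamk.
  rewrite /vandermonde_prod big_ord0 mul1r /alternant det_mx00 /schur_sum.
  have nocell x : cell lam x = false.
    rewrite /cell; have -> : lam x.1 = 0%N by case: x => [[i /=] _ _]; elim: i => // i E;
      have := dec i; rewrite E leqn0 => /eqP.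
    by rewrite ltn0.
  rewrite (big_pred1 [ffun=> ord0]) => [|T].
    by rewrite big_pred0 // => x; rewrite nocell.
  apply/idP/eqP => [/ssytP[H _ _ _]|->].
    by apply/ffunP => x; rewrite ffunE H // nocell.
  by apply/ssytP; split=> [x _|x y|x y|x]; rewrite ?nocell // ffunE.
rewrite (alternant_branching k (S := S.+1)) // (schur_sum_branching kK) //.
rewrite /vandermonde_prod big_ord_recr /= -/(vandermonde_prod k).
rewrite [_ * \prod_(i < k) _]mulrC -[LHS]mulrA; congr (_ * _).
rewrite mulrCA; congr (_ * _); rewrite mulr_sumr; apply: eq_bigr => mu Hmu.
rewrite mulrCA IH //.
- exact: ltnW.
- exact: pad_dec Hmu.
- by rewrite /pad; case: insubP => // j _ _; rewrite -ltnS.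
- exact: pad_out.
Qed.

End Tableaux.

Definition extend0 (K : nat) (lam : 'I_K -> nat) (i : nat) : nat :=
  if insub i is Some j then lam j else 0%N.

Lemma extend0E K (lam : 'I_K -> nat) (i : 'I_K) : extend0 lam i = lam i.
Proof. by rewrite /extend0 valK. Qed.

Theorem bialternant K (lam : 'I_K -> nat) : (0 < K)%N -> is_partition lam ->
  vandermonde_prod K * (\sum_(T | is_ssyt lam T) \prod_(c | in_shape lam c) z (T c)) =
  alternant K (shifted K (extend0 lam)).
Proof.
case: K lam => // K lam _ /forallP part.
have le_part (i j : 'I_K.+1) : (i <= j)%N -> (lam j <= lam i)%N.
  by move/forallP: (part i) => /(_ j)/implyP.
have dec i : (extend0 lam i.+1 <= extend0 lam i)%N.
  have [iK|Ki] := ltnP i.+1 K.+1; last by rewrite /extend0 insubF // ltnNge Ki.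
  rewrite (extend0E lam (Ordinal iK)) (extend0E lam (Ordinal (ltnW iK))).
  exact/le_part/leqnSn.
rewrite -(@schur_sum_alternant K (psize lam)) //; last 2 first.
- rewrite (extend0E lam ord0) /psize (bigD1 ord0) //=; exact: leq_addr.
- by rewrite /extend0 insubF // ltnn.
congr (_ * _); apply: eq_big => [T|T _]; last first.
  by apply: eq_bigl => x; rewrite /cell extend0E.
rewrite /ssyt /is_ssyt andbA [X in _ = _ && X](_ : _ = true) ?andbT; last first.
  by apply/forallP => x; rewrite ltn_ord implybT.
have cE x : cell (S := psize lam) (extend0 lam) x = in_shape lam x.
  by rewrite /cell extend0E.
congr (_ && _); apply: eq_forallb => x; rewrite cE //.
by apply: eq_forallb => y; rewrite cE.
Qed.

End Bialternant.

(** * Difference operators *)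

Section AffineForms.
Variable N : nat.
Implicit Types (x u : 'cV[int]_N).

Definition affine (a : 'cV[int]_N -> int) : Prop :=
  exists h : 'rV[int]_N * int, forall x, a x = aff h x.

Lemma affine_cst c : affine (fun=> c).
Proof. by exists (0, c) => x; rewrite /aff /= mul0mx mxE add0r. Qed.

Lemma affine_coord i : affine (fun x => x i 0).
Proof.
exists (delta_mx 0 i, 0) => x; rewrite /aff /= addr0 mxE (bigD1 i) //= big1.
  by rewrite mxE !eqxx mul1r addr0.
by move=> j /negbTE ji; rewrite mxE ji andbF mul0r.
Qed.

Lemma affineD a b : affine a -> affine b -> affine (fun x => a x + b x).
Proof.
move=> [h E] [k E']; exists (h.1 + k.1, h.2 + k.2) => x.
by rewrite E E' /aff /= mulmxDl [X in _ = X + _]mxE addrACA.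
Qed.

Lemma affineM c a : affine a -> affine (fun x => c * a x).
Proof.
move=> [h E]; exists (c *: h.1, c * h.2) => x.
by rewrite E /aff /= -scalemxAl [X in _ = X + _]mxE mulrDr.
Qed.

Lemma affineB a b : affine a -> affine b -> affine (fun x => a x - b x).
Proof.
move=> Ha /(affineM (-1)) Hb; have [h E] := affineD Ha Hb.
by exists h => x; rewrite -E mulN1r.
Qed.

Lemma affine_sum (I : Type) (r : seq I) (F : I -> 'cV[int]_N -> int) :
  (forall i, affine (F i)) -> affine (fun x => \sum_(i <- r) F i x).
Proof.
move=> H; elim: r => [|i r IH].
  by have [h E] := affine_cst 0; exists h => x; rewrite big_nil -E.
by have [h E] := affineD (H i) IH; exists h => x; rewrite big_cons -E.
Qed.

Definition polyhedral (b : 'cV[int]_N -> bool) : Prop :=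
  exists P : seq ('rV[int]_N * int), forall x, in_piece P x = b x.

Lemma polyhedral_ge0 a : affine a -> polyhedral (fun x => 0 <= a x).
Proof.
move=> [h E]; exists [:: (- h.1, h.2)] => x.
by rewrite E /in_piece /= andbT mulNmx [X in X <= _]mxE /aff lerNl -subr_ge0 opprK addrC.
Qed.

Lemma polyhedralI b c : polyhedral b -> polyhedral c -> polyhedral (fun x => b x && c x).
Proof.
move=> [P E] [Q E']; exists (P ++ Q) => x.
by rewrite -E -E' /in_piece all_cat.
Qed.

Lemma polyhedral_eq0 a : affine a -> polyhedral (fun x => a x == 0).
Proof.
move=> Ha; have := polyhedralI (polyhedral_ge0 Ha) (polyhedral_ge0 (affineM (-1) Ha)).
by case=> P E; exists P => x; rewrite E; lia.
Qed.

Lemma polyhedral_all (I : Type) (r : seq I) (B : I -> 'cV[int]_N -> bool) :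
  (forall i, polyhedral (B i)) -> polyhedral (fun x => all (B^~ x) r).
Proof.
move=> H; elim: r => [|i r IH]; first by exists [::].
by have [P E] := polyhedralI (H i) IH; exists P.
Qed.

Lemma polyhedral_forall (I : finType) (B : I -> 'cV[int]_N -> bool) :
  (forall i, polyhedral (B i)) -> polyhedral (fun x => [forall i, B i x]).
Proof.
move=> /(polyhedral_all (enum I))[P E]; exists P => x; rewrite E.
by apply/allP/forallP => H i; rewrite ?H ?mem_enum.
Qed.

Lemma polyhedral_imply (a : bool) b : polyhedral b -> polyhedral (fun x => a ==> b x).
Proof. by case: a => //= _; exists [::]. Qed.

Lemma pqpoly_polyhedral d (b : 'cV[int]_N -> bool) c :
  polyhedral b -> pqpoly d (fun x => c * (b x)%:R).
Proof.
move=> [P E]; apply: pqpoly_ext (pqpoly_qpoly P (@qpoly_cst N d c)) => x.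
by rewrite E mulrC.
Qed.

End AffineForms.

(** * Difference operators on functions of lattice points *)

Section DifferenceOperators.
Variable N : nat.
Implicit Types (x u : 'cV[int]_N) (c f : 'cV[int]_N -> rat).

(** With [u = a - b], the effect on coefficients of multiplication by [X^a - X^b], up to translation
    by [a]. *)
Definition diff u c x : rat := c x - c (x + u).

Definition diffs (us : seq 'cV[int]_N) c : 'cV[int]_N -> rat := foldr diff c us.

Lemma diffs_cat us vs c : diffs (us ++ vs) c = diffs us (diffs vs c).
Proof. by rewrite /diffs foldr_cat. Qed.

Lemma eq_diffs us c f : c =1 f -> diffs us c =1 diffs us f.
Proof. by elim: us => //= u us IH E x; rewrite /diff !IH. Qed.

Lemma eq_diffs_on (Q : 'cV[int]_N -> Prop) us c f :
  {in us, forall u x, Q x -> Q (x + u)} -> (forall x, Q x -> c x = f x) ->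
  forall x, Q x -> diffs us c x = diffs us f x.
Proof.
elim: us => [|u us IH] HQ E x Qx /=; first exact: E.
have HQ' : {in us, forall u x, Q x -> Q (x + u)}.
  by move=> v vs; apply: HQ; rewrite inE vs orbT.
by rewrite /diff !IH //; apply: HQ; rewrite ?mem_head.
Qed.

Lemma diffs_sum (I : Type) (r : seq I) (a : I -> rat) (F : I -> 'cV[int]_N -> rat) us x :
  diffs us (fun y => \sum_(i <- r) a i * F i y) x = \sum_(i <- r) a i * diffs us (F i) x.
Proof.
elim: us x => //= u us IH x; rewrite /diff !IH -sumrB.
by apply: eq_bigr => i _; rewrite mulrBr.
Qed.

Lemma diffs_invariantM (b : 'cV[int]_N -> rat) us c x :
  {in us, forall u y, b (y + u) = b y} ->
  diffs us (fun y => b y * c y) x = b x * diffs us c x.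
Proof.
elim: us x => //= u us IH x Hb; rewrite /diff !IH => [|v vs|v vs]; last 2 first.
- by apply: Hb; rewrite inE vs orbT.
- by apply: Hb; rewrite inE vs orbT.
by rewrite Hb ?mem_head // mulrBr.
Qed.

(* The indicator of an orthant is the partition function of a family of
   independent vectors. *)
Lemma diffs_orthant (J : eqType) (js : seq J) (al : J -> 'cV[int]_N -> int)
    (u : J -> 'cV[int]_N) (b : 'cV[int]_N -> bool) :
  uniq js ->
  {in js &, forall i j x, al i (x + u j) = al i x - (i == j)%:Z} ->
  {in js, forall j x, b (x + u j) = b x} ->
  diffs [seq u j | j <- js] (fun x => (b x && all (fun j => 0 <= al j x) js)%:R) =1
  (fun x => (b x && all (fun j => al j x == 0) js)%:R).
Proof.
elim: js b => [|j js IH] b //= /andP[njs ujs] Hal Hb x.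
(* The condition at [j] is invariant under the remaining vectors, so it can join [b] in the
   induction hypothesis. *)
have E : diffs [seq u i | i <- js]
   (fun x => (b x && ((0 <= al j x) && all (fun i => 0 <= al i x) js))%:R) =1
   (fun x => (b x && (0 <= al j x) && all (fun i => al i x == 0) js)%:R).
  move=> y; rewrite -(IH (fun x => b x && (0 <= al j x)) ujs); last 2 first.
  - by move=> i i' ijs i'js y'; rewrite Hal // inE ?ijs ?i'js orbT.
  - move=> i ijs y'; rewrite Hb; last by rewrite inE ijs orbT.
    rewrite Hal ?inE ?eqxx ?ijs ?orbT //.
    have -> : (j == i) = false by apply/negbTE; apply: contraNneq njs => ->.
    by rewrite subr0.
  by apply: eq_diffs => y'; rewrite andbA.
rewrite /diff !E Hb ?mem_head // Hal ?mem_head // eqxx.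
have -> : all (fun i => al i (x + u j) == 0) js = all (fun i => al i x == 0) js.
  apply: eq_in_all => i ijs; rewrite Hal ?mem_head //; last by rewrite inE ijs orbT.
  have -> : (i == j) = false by apply/negbTE; apply: contraNneq njs => <-.
  by rewrite subr0.
case: (b x) => //=; case: (all _ js); rewrite ?andbF ?andbT //=.
have -> : (0 <= al j x - 1) = (0 < al j x) by lia.
by case: ltgtP => _; rewrite ?subrr ?subr0.
Qed.

(** * Unique inversion under a support condition *)

Section Triangular.
Variables (L : 'rV[int]_N) (l : int).

Definition weight x : int := (L *m x) 0 0.

Lemma weightD x y : weight (x + y) = weight x + weight y.
Proof. by rewrite /weight mulmxDr mxE. Qed.

Lemma weightZ k x : weight (k *: x) = k * weight x.
Proof. by rewrite /weight -scalemxAr mxE. Qed.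

Definition bounded_below c : Prop := forall x, weight x + l < 0 -> c x = 0.

Definition descending u : bool := weight u < 0.

Lemma bounded_below_diff u c : descending u -> bounded_below c -> bounded_below (diff u c).
Proof.
rewrite /descending => Lu Hc x Lx; rewrite /diff !Hc ?subrr //.
by rewrite weightD; lia.
Qed.

(** The value at [x] follows from the difference and the value at [x + u], which has smaller weight;
    the recursion ends where both functions vanish. *)
Lemma diff_inj u c f : descending u -> bounded_below c -> bounded_below f ->
  diff u c =1 diff u f -> c =1 f.
Proof.
rewrite /descending => Lu Hc Hf E x.
have [t] : exists t : nat, weight x + l < t%:Z by exists (`|(weight x + l)%R|.+1)%N; lia.
elim: t x => [|t IH] x Lx; first by rewrite Hc ?Hf.
have := E x; rewrite /diff (IH (x + u)); last by rewrite weightD; lia.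
exact: addIr.
Qed.

Lemma bounded_below_diffs us c : all descending us -> bounded_below c ->
  bounded_below (diffs us c).
Proof.
move=> Dus Hc; elim: us Dus => //= v us IH /andP[Dv Dus].
exact/bounded_below_diff/IH.
Qed.

Lemma diffs_inj us c f : all descending us -> bounded_below c -> bounded_below f ->
  diffs us c =1 diffs us f -> c =1 f.
Proof.
elim: us c f => //= u us IH c f /andP[Du Dus] Hc Hf E.
apply: IH => //; apply: (diff_inj Du _ _ E); exact: bounded_below_diffs.
Qed.

(** For descending [u] and bounded below [f] this is the full infinite sum: each step lowers the
    integral weight by at least 1, so terms with [k > weight x + l] vanish. The cut-off is affine in
    [x], as [pqpoly_line_sum] requires. *)
Definition line_sum u f x : rat := zsum 0 (aff (L, l + 1) x) (fun k => f (x + k *: u)).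

Lemma bounded_below_line_sum u f : bounded_below (line_sum u f).
Proof. by move=> x Lx; rewrite /line_sum zsum_geq // /aff /= -/(weight x); lia. Qed.

Lemma diff_line_sum u f : descending u -> bounded_below f -> diff u (line_sum u f) =1 f.
Proof.
rewrite /descending => Lu Hf x; rewrite /diff /line_sum /aff /=.
rewrite -/(weight x) -/(weight (x + u)) weightD.
have Lk k : weight (x + k *: u) = weight x + k * weight u by rewrite weightD weightZ.
have zsum0 a b : zsum a b (fun=> 0) = 0 by rewrite /zsum; case: ifP => // _; rewrite big1.
have [B0|B0] := leP (weight x + (l + 1)) 0.
  by rewrite !zsum_geq ?subrr ?Hf //; lia.
(* The sum at [x + u] stops earlier when [u] has weight below -1; the terms added to reach the
   common end are zero. *)
have -> : zsum 0 (weight x + weight u + (l + 1)) (fun k => f (x + u + k *: u)) =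
          zsum 0 (weight x + l) (fun k => f (x + (k + 1) *: u)).
  have E k : x + u + k *: u = x + (k + 1) *: u.
    by rewrite -addrA -{1}[u]scale1r -scalerDl [1 + k]addrC.
  have [C0|C0] := leP 0 (weight x + weight u + (l + 1)).
    rewrite [RHS](@zsum_cat (weight x + weight u + (l + 1))) //; last by lia.
    rewrite [X in _ = _ + X](@eq_zsum _ _ _ (fun=> 0)) => [|k kr].
      by rewrite zsum0 addr0; apply: eq_zsum => k _; rewrite E.
    by rewrite Hf // Lk; nia.
  rewrite zsum_geq; last by lia.
  rewrite (@eq_zsum _ _ _ (fun=> 0)) ?zsum0 // => k kr.
  by rewrite Hf // Lk; nia.
rewrite /zsum (ltW B0); have -> : 0 <= weight x + l by lia.
have -> : (`|(weight x + (l + 1))%R - 0| = `|(weight x + l)%R - 0|.+1)%N by lia.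
rewrite big_nat_recl //= addr0 scale0r addr0 -[LHS]addrA -[RHS]addr0; congr (_ + _).
apply/eqP; rewrite subr_eq0; apply/eqP.
by apply: eq_bigr => t _; rewrite !add0r -PoszD addn1.
Qed.

Definition line_sums us f := foldr line_sum f us.

(** Each sum costs one degree. The list is reversed because the outermost sum has to be undone
    first. *)
Lemma line_sumsP d us f : all descending us -> bounded_below f -> pqpoly d f ->
  [/\ pqpoly (size us + d) (line_sums us f), bounded_below (line_sums us f)
    & diffs (rev us) (line_sums us f) =1 f].
Proof.
move=> Dus Hf pf; elim: us Dus => //= u us IH /andP[Du /IH[p1 b1 E1]]; split.
- exact: pqpoly_line_sum.
- exact: bounded_below_line_sum.
- rewrite rev_cons -cats1 diffs_cat /= => x.
  by rewrite -E1; apply: eq_diffs => y; rewrite diff_line_sum.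
Qed.

End Triangular.
End DifferenceOperators.

(** * The Kronecker function *)

Section Pairs.
Local Open Scope nat_scope.

Definition pairs (K : nat) : seq (nat * nat) := [seq (e, f) | f <- iota 0 K, e <- iota 0 f].

Lemma mem_pairs K p : (p \in pairs K) = (p.1 < p.2 < K).
Proof.
apply/allpairsPdep/andP => [[f [e []]]|[lt12 lt2]].
  by rewrite !mem_iota /= => fK ef ->.
by exists p.2, p.1; rewrite !mem_iota /= lt2 lt12; split=> //; case: p {lt12 lt2}.
Qed.

Lemma pairs_uniq K : uniq (pairs K).
Proof.
apply: allpairs_uniq_dep => [|f _|[f e] [f' e'] _ _ /= [-> ->]] //; exact: iota_uniq.
Qed.

Lemma size_pairs K : size (pairs K) = 'C(K, 2).
Proof.
rewrite size_allpairs_dep (eq_map (g := id)) => [|f]; last by rewrite size_iota.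
by rewrite map_id sumnE -bin2_sum /index_iota subn0.
Qed.

Variables n m : nat.
Hypotheses (hn : 1 < n) (hm : 1 < m).

(* Below, [e < n * m] encodes the variable [x_(e %/ m) * y_(e %% m)]. *)
Definition xpairs := [seq (p.1 * m, p.2 * m) | p <- pairs n].
(** The variables [x_0 y_1] and [x_k y_1], with direction [x_0 - x_k]; the pairs at [y_0] are taken
    by [xpairs]. Likewise [ybasis] uses [x_1], since [pairs m] occupies [x_0]. *)
Definition xbasis := [seq (1, k * m + 1) | k <- iota 1 n.-1].
Definition ybasis := [seq (m, m + l) | l <- iota 1 m.-1].
Definition other_pairs :=
  [seq p <- pairs (n * m) | p \notin xpairs ++ pairs m ++ xbasis ++ ybasis].

Lemma mem_xpairs p : p \in xpairs -> [/\ m %| p.1, m %| p.2 & p.1 < p.2 < n * m].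
Proof.
case/mapP => q; rewrite mem_pairs => /andP[q12 qn] -> /=.
by rewrite !dvdn_mull // !ltn_pmul2r ?q12 ?qn //; lia.
Qed.

Lemma mem_xbasis p : p \in xbasis -> [/\ p.1 = 1, p.2 %% m = 1, m <= p.2 & p.2 < n * m].
Proof.
case/mapP => k; rewrite mem_iota => /andP[k1 kn] -> /=; split=> //.
- by rewrite modnMDl modn_small.
- nia.
- nia.
Qed.

Lemma mem_ybasis p : p \in ybasis -> [/\ p.1 = m, m < p.2 & p.2 < m + m].
Proof. by case/mapP => l; rewrite mem_iota => /andP[l1 lm] -> /=; split; lia. Qed.

(** Residues and sizes separate the lists: [xpairs] consists of multiples of [m], [pairs m] stays
    below [m], [xbasis] starts at 1 and ends at [m] or later, [ybasis] starts at [m] and ends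
    strictly between [m] and [2m]. *)
Lemma pairs_decomposition :
  perm_eq (pairs (n * m)) (xpairs ++ pairs m ++ (xbasis ++ ybasis ++ other_pairs)).
Proof.
rewrite !catA perm_sym -!catA.
have -> : xpairs ++ pairs m ++ xbasis ++ ybasis ++ other_pairs =
  (xpairs ++ pairs m ++ xbasis ++ ybasis) ++ other_pairs by rewrite -!catA.
set s := _ ++ _ ++ _ ++ ybasis.
have sub : {subset s <= pairs (n * m)}.
  move=> p; rewrite mem_pairs !mem_cat => /or4P[/mem_xpairs[] //||/mem_xbasis[]|/mem_ybasis[]].
  - by rewrite mem_pairs; nia.
  - nia.
  - nia.
have us : uniq s.
  rewrite /s !cat_uniq pairs_uniq !map_inj_uniq ?iota_uniq ?pairs_uniq /=; first last.
  - by move=> [a b] [a' b'] /= [/eqP E /eqP E']; move: E E'; rewrite !eqn_pmul2r; try lia;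
      move=> /eqP -> /eqP ->.
  - by move=> k k' [/eqP]; rewrite eqn_add2r eqn_pmul2r; last lia; move/eqP.
  - by move=> k k' [/eqP]; rewrite eqn_add2l => /eqP.
  rewrite andbT; apply/and3P; split; apply/hasPn => p.
  - rewrite !mem_cat => /or3P[|/mem_xbasis|/mem_ybasis].
    + rewrite mem_pairs => /andP[p12 pm]; apply/negP => /mem_xpairs[_ /dvdnP[b E] _].
      by case: b E => [|b]; rewrite ?mulSn; lia.
    + move=> [E1 _ _ _]; apply/negP => /mem_xpairs[]; rewrite E1 dvdn1; lia.
    + move=> [E1 E2 E3]; apply/negP => /mem_xpairs[_ /dvdnP[b E] _].
      by case: b E => [|[|b]]; rewrite ?mulSn; lia.
  - rewrite !mem_cat => /orP[/mem_xbasis|/mem_ybasis].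
    + by move=> [E1 _ E _]; rewrite mem_pairs; lia.
    + by move=> [E1 _ E]; rewrite mem_pairs; lia.
  - move=> /mem_ybasis[E1 _ _]; apply/negP => /mem_xbasis[]; lia.
apply: uniq_perm; last 1 first.
- move=> p; rewrite mem_cat mem_filter; have [/sub -> //|] := boolP (p \in s).
  by [].
- rewrite cat_uniq us filter_uniq ?pairs_uniq // andbT; apply/hasPn => p.
  by rewrite mem_filter => /andP[].
- exact: pairs_uniq.
Qed.

Lemma size_other_pairs :
  size other_pairs = 'C(n * m, 2) - 'C(n, 2) - 'C(m, 2) - (n + m - 2).
Proof.
have := perm_size pairs_decomposition.
rewrite !size_cat !size_map !size_iota !size_pairs; lia.
Qed.

End Pairs.

Lemma vandermonde_prod_pairs (R : comNzRingType) (z : nat -> R) K :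
  vandermonde_prod z K = \prod_(p <- pairs K) (z p.1 - z p.2).
Proof.
rewrite /pairs big_allpairs_dep /vandermonde_prod.
rewrite -(big_mkord xpredT (fun j => \prod_(i < j) (z i - z j))) /index_iota subn0.
apply: eq_bigr => j _.
by rewrite -(big_mkord xpredT (fun i => z i - z j)) /index_iota subn0.
Qed.

(** Each of the ['C(n, 2)] differences at [y_0] gives a factor [y_0], and each of the ['C(m, 2)]
    differences at [x_0] a factor [x_0]. *)
Lemma vandermonde_xy (R : comNzRingType) (x y : nat -> R) n m : (1 < n)%N -> (1 < m)%N ->
  let z e := x (e %/ m)%N * y (e %% m)%N in
  vandermonde_prod z (n * m) = x 0 ^+ 'C(m, 2) * y 0 ^+ 'C(n, 2) *
    (\prod_(p <- xbasis n m ++ ybasis m ++ other_pairs n m) (z p.1 - z p.2)) *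
    (vandermonde_prod x n * vandermonde_prod y m).
Proof.
move=> hn hm z; rewrite !vandermonde_prod_pairs (perm_big _ (pairs_decomposition hn hm)) /=.
rewrite big_cat [X in _ * X = _]big_cat /= big_map /=.
have const_prod (a : R) (r : seq (nat * nat)) : \prod_(p <- r) a = a ^+ size r.
  by elim: r => [|p r IH]; rewrite ?big_nil ?big_cons ?IH ?exprS.
rewrite (eq_bigr (fun p => y 0 * (x p.1 - x p.2))); last first.
  by move=> p _; rewrite /z !mulnK ?modnMl 1?[y 0 * _]mulrC ?mulrBl //; lia.
rewrite big_split /= const_prod size_pairs.
have -> : \prod_(p <- pairs m) (z p.1 - z p.2) =
    x 0 ^+ 'C(m, 2) * \prod_(p <- pairs m) (y p.1 - y p.2).
  rewrite -size_pairs -const_prod -big_split /= big_seq [RHS]big_seq.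
  apply: eq_bigr => p; rewrite mem_pairs => /andP[p12 pm].
  by rewrite /z !divn_small ?modn_small ?mulrBr //; apply: ltn_trans pm.
set A := \prod_(p <- pairs n) _; set B := \prod_(p <- pairs m) _; set C := \prod_(p <- _) _.
set a := x 0 ^+ _; set b := y 0 ^+ _; ring.
Qed.

Lemma mpolyX_bigprod (N : nat) (I : finType) (P : pred I) (F : I -> 'X_{1..N}) :
  \prod_(i | P i) 'X_[F i] = 'X_[(\sum_(i | P i) F i)%MM] :> {mpoly rat[N]}.
Proof. by rewrite (big_morph _ (@mpolyXD N rat) (@mpolyX0 N rat)). Qed.

(** * The defining identity as an identity of polynomials *)

Section KroneckerPolynomials.
Variables n m : nat.

Local Notation mono := 'X_{1..n + m}.

Definition ux (i : nat) : mono := if insub i is Some j then U_(lshift m j)%MM else 0%MM.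
Definition uy (i : nat) : mono := if insub i is Some j then U_(rshift n j)%MM else 0%MM.
Definition mz (e : nat) : mono := (ux (e %/ m) + uy (e %% m))%MM.

Definition xv (i : nat) : {mpoly rat[n + m]} := 'X_[ux i].
Definition yv (i : nat) : {mpoly rat[n + m]} := 'X_[uy i].

Lemma uxE (i : nat) (k : 'I_n) : ux i (lshift m k) = (i == k :> nat).
Proof.
rewrite /ux; case: insubP => [j _ <-|ni].
  by rewrite mnm1E eq_lshift.
by rewrite mnm0E; case: eqP => // E; rewrite E ltn_ord in ni.
Qed.

Lemma ux_r (i : nat) (k : 'I_m) : ux i (rshift n k) = 0%N.
Proof. by rewrite /ux; case: insub => [j|]; rewrite ?mnm0E // mnm1E eq_lrshift. Qed.

Lemma uyE (i : nat) (k : 'I_m) : uy i (rshift n k) = (i == k :> nat).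
Proof.
rewrite /uy; case: insubP => [j _ <-|ni].
  by rewrite mnm1E eq_rshift.
by rewrite mnm0E; case: eqP => // E; rewrite E ltn_ord in ni.
Qed.

Lemma uy_l (i : nat) (k : 'I_n) : uy i (lshift m k) = 0%N.
Proof. by rewrite /uy; case: insub => [j|]; rewrite ?mnm0E // mnm1E eq_rlshift. Qed.

Lemma mono_eqE (a b : mono) : (a == b) =
  [forall i : 'I_n, a (lshift m i) == b (lshift m i)] &&
  [forall j : 'I_m, a (rshift n j) == b (rshift n j)].
Proof.
apply/eqP/andP => [->|[/forallP H1 /forallP H2]].
  by split; apply/forallP.
apply/mnmP => i; case: (split_ordP i) => k ->; exact/eqP.
Qed.

Lemma sum_eq_card (I : finType) (P : pred I) (f : I -> nat) (k : nat) :
  (\sum_(c | P c) (f c == k) = #|[set c | P c && (f c == k)]|)%N.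
Proof. by rewrite -sum1dep_card big_mkcondr. Qed.

Definition schur_poly (K : nat) (v : nat -> {mpoly rat[n + m]}) (mu : 'I_K -> nat) :=
  \sum_(T | is_ssyt mu T) \prod_(c | in_shape mu c) v (T c).

(** The two Schur polynomials involve disjoint sets of variables, so the coefficient is a product of
    Kostka numbers. *)
Lemma mcoeff_schur_product (mu : 'I_n -> nat) (nu : 'I_m -> nat) (w : mono) :
  (schur_poly xv mu * schur_poly yv nu)@_w =
  (kostka mu (fun i => w (lshift m i)))%:R * (kostka nu (fun j => w (rshift n j)))%:R.
Proof.
rewrite /schur_poly big_distrlr /= raddf_sum /=.
rewrite /kostka -!sum1dep_card !natr_sum big_distrlr /=.
rewrite [RHS]big_mkcondr; apply: eq_bigr => T _ /=.
rewrite raddf_sum /=.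
transitivity (\sum_(T' | is_ssyt nu T')
  ([forall i : 'I_n, #|[set c | in_shape mu c && (T c == i)]| == w (lshift m i)] &&
   [forall j : 'I_m, #|[set c | in_shape nu c && (T' c == j)]| == w (rshift n j)])%:R : rat).
  apply: eq_bigr => T' _.
  rewrite !mpolyX_bigprod -mpolyXD mcoeffX mono_eqE; congr ((_ && _)%:R).
    apply: eq_forallb => i; rewrite mnmDE !mnm_sumE [X in (_ + X)%N]big1 ?addn0.
      by rewrite (eq_bigr _ (fun c _ => uxE (T c) i)) sum_eq_card.
    by move=> c _; rewrite uy_l.
  apply: eq_forallb => j; rewrite mnmDE !mnm_sumE [X in (X + _)%N]big1 ?add0n.
    by rewrite (eq_bigr _ (fun c _ => uyE (T' c) j)) sum_eq_card.
  by move=> c _; rewrite ux_r.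
case: ifP => _; last by rewrite big1.
by rewrite [RHS]big_mkcondr; apply: eq_bigr => T' _; case: ifP; rewrite ?mulr1.
Qed.

Lemma mcoeff_schur_xy (lam : 'I_(n * m) -> nat) (w : mono) :
  (schur_poly (fun e => xv (e %/ m) * yv (e %% m)) lam)@_w =
  (sxy_coef lam (fun i => w (lshift m i)) (fun j => w (rshift n j)))%:R.
Proof.
rewrite /schur_poly raddf_sum /= /sxy_coef -sum1dep_card natr_sum.
under [RHS]eq_bigl => T do rewrite -andbA.
rewrite [RHS]big_mkcondr; apply: eq_bigr => T _ /=.
rewrite big_split /= !mpolyX_bigprod -mpolyXD mcoeffX mono_eqE.
set b1 := [forall i, _]; set b2 := [forall j, _].
set b3 := [forall i, _]; set b4 := [forall j, _].
have -> : b1 = b3.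
  apply: eq_forallb => i; rewrite mnmDE !mnm_sumE [X in (_ + X)%N]big1 ?addn0.
    by rewrite (eq_bigr _ (fun c _ => uxE (T c %/ m) i)) sum_eq_card.
  by move=> c _; rewrite uy_l.
have -> : b2 = b4.
  apply: eq_forallb => j; rewrite mnmDE !mnm_sumE [X in (X + _)%N]big1 ?add0n.
    by rewrite (eq_bigr _ (fun c _ => uyE (T c %% m) j)) sum_eq_card.
  by move=> c _; rewrite ux_r.
by case: (b3 && b4).
Qed.

Variable g : {ffun 'I_n -> nat} -> {ffun 'I_m -> nat} -> {ffun 'I_(n * m) -> nat} -> rat.
Hypothesis hg : is_kronecker g.

Definition is_pn (K S : nat) (mu : {ffun 'I_K -> 'I_S.+1}) : bool :=
  is_partition (fun i => val (mu i)) && (psize (fun i => val (mu i)) == S).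

Lemma kronecker_schur (lam : {ffun 'I_(n * m) -> nat}) : is_partition lam ->
  schur_poly (fun e => xv (e %/ m) * yv (e %% m)) lam =
  \sum_(mu : {ffun 'I_n -> 'I_(psize lam).+1} | is_pn mu)
  \sum_(nu : {ffun 'I_m -> 'I_(psize lam).+1} | is_pn nu)
    g [ffun i => val (mu i)] [ffun j => val (nu j)] lam *:
      (schur_poly xv (fun i => val (mu i)) * schur_poly yv (fun j => val (nu j))).
Proof.
move=> part; apply/mpolyP => w; rewrite mcoeff_schur_xy (hg part).
rewrite raddf_sum; apply: eq_bigr => mu _; rewrite raddf_sum; apply: eq_bigr => nu _ /=.
by rewrite mcoeffZ mcoeff_schur_product mulrA.
Qed.

Hypotheses (hn : (1 < n)%N) (hm : (1 < m)%N).

(** For a partition [lam] this is the Schur polynomial in the [x_i y_j] times both Vandermonde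
    products, written in the basis of alternants. *)
Definition kron_poly (lam : {ffun 'I_(n * m) -> nat}) : {mpoly rat[n + m]} :=
  \sum_(mu : {ffun 'I_n -> 'I_(psize lam).+1} | is_pn mu)
  \sum_(nu : {ffun 'I_m -> 'I_(psize lam).+1} | is_pn nu)
    g [ffun i => val (mu i)] [ffun j => val (nu j)] lam *:
      (alternant xv n (shifted n (extend0 (fun i => val (mu i)))) *
       alternant yv m (shifted m (extend0 (fun j => val (nu j))))).

Lemma kron_polyE (lam : {ffun 'I_(n * m) -> nat}) : is_partition lam ->
  xv 0 ^+ 'C(m, 2) * yv 0 ^+ 'C(n, 2) *
    (\prod_(p <- xbasis n m ++ ybasis m ++ other_pairs n m) ('X_[mz p.1] - 'X_[mz p.2]))
    * kron_poly lam =
  alternant (fun e => 'X_[mz e]) (n * m) (shifted (n * m) (extend0 lam)).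
Proof.
move=> part.
have -> : kron_poly lam = vandermonde_prod xv n * vandermonde_prod yv m *
    schur_poly (fun e => xv (e %/ m) * yv (e %% m)) lam.
  rewrite kronecker_schur // mulr_sumr; apply: eq_bigr => mu /andP[pmu _].
  rewrite mulr_sumr; apply: eq_bigr => nu /andP[pnu _].
  rewrite -!bialternant ?(ltnW hn) ?(ltnW hm) // -scalerAr; congr (_ *: _).
  by rewrite /schur_poly mulrACA.
have zE e : 'X_[mz e] = xv (e %/ m) * yv (e %% m) by rewrite /mz mpolyXD.
have := bialternant (fun e => xv (e %/ m) * yv (e %% m)) _ part.
rewrite muln_gt0 (ltnW hn) (ltnW hm) => /(_ isT).
rewrite (vandermonde_xy _ _ hn hm) => E; rewrite mulrA.
transitivity (alternant (fun e => xv (e %/ m) * yv (e %% m)) (n * m)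
  (shifted (n * m) (extend0 lam))).
  rewrite -E; congr (_ * _ * _ * _); apply: eq_bigr => p _; by rewrite !zE.
by rewrite /alternant; congr (\det _); apply/matrixP => i j; rewrite !mxE zE.
Qed.

End KroneckerPolynomials.

Lemma increasing_perm1 k (s : 'S_k) : (forall i j : 'I_k, (i < j)%N -> (s i < s j)%N) -> s = 1%g.
Proof.
move=> inc.
have ge (t : 'S_k) : (forall i j : 'I_k, (i < j)%N -> (t i < t j)%N) -> forall i : 'I_k, (i <= t i)%N.
  move=> tinc [i ik]; elim: i ik => // i IH ik /=.
  have ik' := ltnW ik; apply: leq_ltn_trans (IH ik') _; exact: tinc.
have inc' (i j : 'I_k) : (i < j)%N -> ((s^-1)%g i < (s^-1)%g j)%N.
  move=> ij; rewrite ltnNge; apply/negP; rewrite leq_eqVlt => /orP[/eqP/val_inj/perm_inj E|lt].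
    by rewrite E ltnn in ij.
  by have := inc _ _ lt; rewrite !permKV ltnNge (ltnW ij).
apply/permP => i; rewrite perm1; apply/val_inj/eqP; rewrite eqn_leq ge // andbT.
by have := ge _ inc' (s i); rewrite permK.
Qed.

(** Among the monomials of an alternant, only the one of the identity permutation has decreasing
    exponents; this isolates single coefficients. *)
Lemma decreasing_perm_eq k (s : 'S_k) (l l' : 'I_k -> nat) :
  (forall i j : 'I_k, (i < j)%N -> (l j < l i)%N) ->
  (forall i j : 'I_k, (i < j)%N -> (l' j < l' i)%N) ->
  (forall j, l j = l' (s j)) -> s = 1%g /\ l =1 l'.
Proof.
move=> dl dl' E.
have s1 : s = 1%g.
  apply: increasing_perm1 => i j ij; rewrite ltnNge; apply/negP.
  rewrite leq_eqVlt => /orP[/eqP/val_inj/perm_inj ji|lt]; first by rewrite ji ltnn in ij.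
  by have := dl' _ _ lt; rewrite -!E ltnNge (ltnW (dl _ _ ij)).
by split=> // j; rewrite E s1 perm1.
Qed.

Lemma shifted_decreasing k (lam : 'I_k -> nat) : is_partition lam ->
  forall i j : 'I_k, (i < j)%N -> (shifted k (extend0 lam) j < shifted k (extend0 lam) i)%N.
Proof.
move=> /forallP part i j ij; rewrite /shifted !extend0E.
have /forallP/(_ j)/implyP/(_ (ltnW ij)) := part i; have := ltn_ord j; lia.
Qed.

(** * Coefficient functions on the space of triples *)

Section KroneckerFunction.
Variables n m : nat.

Local Notation mono := 'X_{1..n + m}.
Local Notation space := 'cV[int]_(kN n m).
Local Notation wpos := (@lshift (n + m) (n * m)).
Local Notation mz := (mz n m).

Definition vec (a : mono) : space :=
  \col_k (if split k is inl i then (a i)%:Z else 0).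

Lemma vecE a i : vec a (wpos i) 0 = a i.
Proof. by rewrite mxE (unsplitK (inl _ i)). Qed.

Lemma vec_clam a k : vec a (clam n m k) 0 = 0.
Proof. by rewrite mxE (unsplitK (inr _ k)). Qed.

Lemma vecD a b : vec (a + b)%MM = vec a + vec b.
Proof.
apply/colP => k; case: (split_ordP k) => i ->.
  by rewrite [RHS]mxE !vecE mnmDE PoszD.
by rewrite [RHS]mxE !vec_clam.
Qed.

Definition wexp (x : space) : mono := [multinom `|x (wpos i) 0%R|%N | i < n + m].

(* Coefficients of [p], extended by zero to negative exponents. *)
Definition wcoef (p : {mpoly rat[n + m]}) (x : space) : rat :=
  if [forall i, 0 <= x (wpos i) 0] then p@_(wexp x) else 0.

Lemma wcoef_sum (I : finType) (P : pred I) (F : I -> {mpoly rat[n + m]}) x :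
  wcoef (\sum_(i | P i) F i) x = \sum_(i | P i) wcoef (F i) x.
Proof. by rewrite /wcoef; case: ifP => _; rewrite ?raddf_sum // big1. Qed.

Lemma wcoef_scale c p x : wcoef (c *: p) x = c * wcoef p x.
Proof. by rewrite /wcoef mcoeffZ; case: ifP; rewrite ?mulr0. Qed.

Lemma wcoefX a x : wcoef 'X_[a] x = ([forall i, x (wpos i) 0 == (a i)%:Z])%:R.
Proof.
rewrite /wcoef mcoeffX; case: ifP => [/forallP x0|/negbT/forallPn[i ni]].
  congr (nat_of_bool _)%:R; apply/eqP/forallP => [-> i|H].
    by rewrite mnmE gez0_abs.
  by apply/mnmP => i; rewrite mnmE (eqP (H i)).
by case: forallP => // /(_ i)/eqP E; rewrite E in ni.
Qed.

(** Valid for every integral [x]: where [x] has a negative exponent, [X^a p] has no monomial at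
    [x + a], matching the extension by zero. *)
Lemma wcoefMX a p x : wcoef ('X_[a] * p) (x + vec a) = wcoef p x.
Proof.
have xE i : (x + vec a) (wpos i) 0 = x (wpos i) 0 + (a i)%:Z by rewrite mxE vecE.
rewrite /wcoef; case: ifP => [/forallP xa0|].
  case: ifP => [/forallP x0|/negbT/forallPn[i]].
    have -> : wexp (x + vec a) = (a + wexp x)%MM.
      apply/mnmP => i; rewrite mnmE mnmDE mnmE xE; have := x0 i.
      by move: (x (wpos i) 0) => v; lia.
    by rewrite mulrC mcoeffMX.
  move=> ni; apply: memN_msupp_eq0; rewrite mulrC (perm_mem (msuppMX _ _)).
  apply/negP => /mapP[q _ /mnmP/(_ i)]; rewrite mnmE mnmDE xE.
  by have := xa0 i; rewrite xE; move: (x (wpos i) 0) ni => v; lia.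
move=> /negbT/forallPn[i]; rewrite xE => ni; case: ifP => // /forallP/(_ i).
by move: (x (wpos i) 0) ni => v; lia.
Qed.

Lemma wcoef_binomial a b p x :
  wcoef (('X_[a] - 'X_[b]) * p) (x + vec a) = diff (vec a - vec b) (wcoef p) x.
Proof.
have wcoefB q r y : wcoef (q - r) y = wcoef q y - wcoef r y.
  by rewrite /wcoef mcoeffB; case: ifP; rewrite ?subr0.
rewrite mulrBl wcoefB wcoefMX /diff; congr (_ - _).
by rewrite -[RHS](wcoefMX b) addrA subrK.
Qed.

Definition pvec (p : nat * nat) : space := vec (mz p.1) - vec (mz p.2).

Lemma wcoef_binomials (s : seq (nat * nat)) p x :
  wcoef ((\prod_(t <- s) ('X_[mz t.1] - 'X_[mz t.2])) * p)
    (x + vec (\sum_(t <- s) mz t.1)%MM) = diffs [seq pvec t | t <- s] (wcoef p) x.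
Proof.
elim: s x => [|t s IH] x /=.
  rewrite !big_nil mul1r; congr wcoef; apply/colP => k; rewrite mxE.
  by case: (split_ordP k) => i ->; rewrite ?vecE ?vec_clam ?mnm0E addr0.
rewrite !big_cons vecD [vec _ + vec _]addrC addrA -mulrA wcoef_binomial /diff.
rewrite IH; congr (_ - _); rewrite -IH; congr wcoef.
by rewrite addrAC.
Qed.

Lemma wcoef_alternant l x : wcoef (alternant (fun e => 'X_[mz e]) (n * m) l) x =
  \sum_(s : 'S_(n * m)) (-1) ^+ s *
    ([forall i, x (wpos i) 0 == (\sum_(e < n * m) mz (s e) i * l e)%N%:Z])%:R.
Proof.
rewrite /alternant /determinant wcoef_sum; apply: eq_bigr => s _.
have -> : (-1) ^+ s * \prod_i (\matrix_(j, i0) 'X_[mz i0] ^+ l j) i (s i) =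
    (-1) ^+ s *: 'X_[(\sum_(e < n * m) mz (s e) *+ l e)%MM] :> {mpoly rat[n + m]}.
  rewrite -mpolyX_bigprod scaler_sign mulr_sign; congr (if _ then - _ else _);
    by apply: eq_bigr => e _; rewrite mxE mpolyXn.
rewrite wcoef_scale wcoefX; congr (_ * (nat_of_bool _)%:R).
by apply: eq_forallb => i; rewrite mnm_sumE; under eq_bigr do rewrite mulmnE.
Qed.

(* A functional that takes the value [e] on the exponent of the variable number [e]. *)
Definition wtrow : 'rV[int]_(kN n m) :=
  \row_k (if split k is inl i then
    (match split i with inl a => m * a | inr b => b end)%N%:Z else 0).

Lemma weightE x : weight wtrow x =
  \sum_(i < n) (m * i)%N%:Z * x (cmu n m i) 0 + \sum_(j < m) j%:Z * x (cnu n m j) 0.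
Proof.
rewrite /weight mxE !big_split_ord /= [X in _ + X]big1 ?addr0.
  congr (_ + _); apply: eq_bigr => i _; rewrite mxE (unsplitK (inl _ _)).
    by rewrite (unsplitK (inl _ i)).
  by rewrite (unsplitK (inr _ i)).
by move=> i _; rewrite mxE (unsplitK (inr _ _)) mul0r.
Qed.

Lemma cmuE i : cmu n m i = wpos (lshift m i). Proof. by []. Qed.
Lemma cnuE j : cnu n m j = wpos (rshift n j). Proof. by []. Qed.

Lemma mz_l e (i : 'I_n) : mz e (lshift m i) = (e %/ m == i)%N.
Proof. by rewrite mnmDE uxE uy_l addn0. Qed.

Lemma mz_r e (j : 'I_m) : mz e (rshift n j) = (e %% m == j)%N.
Proof. by rewrite mnmDE ux_r uyE. Qed.

Lemma sum_delta K (a : nat) (F : nat -> int) : (a < K)%N ->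
  \sum_(i < K) F i * (a == i :> nat)%:Z = F a.
Proof.
move=> aK; rewrite (bigD1 (Ordinal aK)) //= eqxx mulr1 big1 ?addr0 // => i ia.
have -> : (a == i :> nat) = false; last by rewrite mulr0.
by apply/negbTE; apply: contra ia => /eqP ai; apply/eqP/val_inj.
Qed.

Lemma weight_mz e : (e < n * m)%N -> weight wtrow (vec (mz e)) = e.
Proof.
move=> enm; have m0 : (0 < m)%N by case: m enm => //; rewrite muln0.
rewrite weightE.
under eq_bigr => i _ do rewrite cmuE vecE mz_l.
under [X in _ + X]eq_bigr => j _ do rewrite cnuE vecE mz_r.
rewrite (@sum_delta n (e %/ m) (fun i => (m * i)%N%:Z)) ?ltn_divLR //.
rewrite (@sum_delta m (e %% m) (fun i => i%:Z)) ?ltn_mod //.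
by rewrite -PoszD mulnC -divn_eq.
Qed.

(** The weight of [pvec p] is [p.1 - p.2], so one functional serves all directions at once. *)
Lemma pvec_descending (s : seq (nat * nat)) : {subset s <= pairs (n * m)} ->
  all (descending wtrow) [seq pvec t | t <- s].
Proof.
move=> sub; rewrite all_map; apply/allP => p /sub; rewrite mem_pairs => /andP[lt1 lt2] /=.
have := weightD wtrow (pvec p) (vec (mz p.2)).
rewrite {1}/pvec subrK !weight_mz ?(ltn_trans lt1) // /descending.
by move: (weight _ _) lt1 => v; case: p {lt2} => a b /=; lia.
Qed.

Lemma wcoef_bounded p l : 0 <= l -> bounded_below wtrow l (wcoef p).
Proof.
move=> l0 x xl; rewrite /wcoef; case: ifP => // /forallP x0.
have : 0 <= weight wtrow x.
  by rewrite weightE addr_ge0 // sumr_ge0 // => i _; rewrite mulr_ge0 // (x0 (lshift _ _), x0 (rshift _ _)).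
lia.
Qed.

Hypotheses (hn : (1 < n)%N) (hm : (1 < m)%N).

Definition factor_pairs := xbasis n m ++ ybasis m ++ other_pairs n m.

Lemma factor_pairs_sub : {subset factor_pairs <= pairs (n * m)}.
Proof.
by move=> p pf; rewrite (perm_mem (pairs_decomposition hn hm)) 2!mem_cat -/factor_pairs pf !orbT.
Qed.

(* Dividing by [X^a - X^b] translates exponents by [a]; these translations add up. *)
Definition total_shift : mono :=
  ((\sum_(t <- factor_pairs) mz t.1) + (ux n m 0 *+ 'C(m, 2) + uy n m 0 *+ 'C(n, 2)))%MM.

Lemma pvec_clam p k : pvec p (clam n m k) 0 = 0.
Proof. by rewrite /pvec mxE [X in _ + X]mxE !vec_clam subrr. Qed.

Definition lam_of (x : space) : {ffun 'I_(n * m) -> nat} := [ffun e => `|x (clam n m e) 0%R|%N].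

(** The region where the absolute values in [lam_of] are harmless and give a partition; the
    functions below are set to zero outside it. *)
Definition good (x : space) : bool :=
  [forall e, 0 <= x (clam n m e) 0] &&
  [forall e : 'I_(n * m), forall f : 'I_(n * m),
     (e <= f)%N ==> (0 <= x (clam n m e) 0 - x (clam n m f) 0)].

Lemma good_partition x : good x -> is_partition (lam_of x).
Proof.
case/andP=> /forallP x0 /forallP H; apply/forallP => e; apply/forallP => f.
have /forallP/(_ f) := H e; case: (e <= f)%N => //=; rewrite !ffunE.
have := x0 e; have := x0 f.
by move: (x (clam n m e) 0) (x (clam n m f) 0) => a b; lia.
Qed.

Lemma polyhedral_good : polyhedral good.
Proof.
apply: polyhedralI; apply: polyhedral_forall => e.
  exact/polyhedral_ge0/affine_coord.
apply: polyhedral_forall => f; apply: polyhedral_imply.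
by apply/polyhedral_ge0/affineB; apply: affine_coord.
Qed.

(* The exponent of a term of [kron_poly] minus that of the monomial indexed by [s] in
   the alternant of [lam], up to [total_shift]. *)
Definition zeta (s : 'S_(n * m)) (i : 'I_(n + m)) (x : space) : int :=
  x (wpos i) 0 + (total_shift i)%:Z -
  \sum_(e < n * m) (mz (s e) i)%:Z * (x (clam n m e) 0 + (n * m - e.+1)%N%:Z).

Lemma affine_zeta s i : affine (zeta s i).
Proof.
apply: affineB; first by apply: affineD; [apply: affine_coord | apply: affine_cst].
apply: affine_sum => e; apply: affineM.
by apply: affineD; [apply: affine_coord | apply: affine_cst].
Qed.

Lemma zeta_pvec s i x p :
  zeta s i (x + pvec p) = zeta s i x + ((mz p.1 i)%:Z - (mz p.2 i)%:Z).
Proof.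
have -> : zeta s i (x + pvec p) = (x (wpos i) 0 + ((mz p.1 i)%:Z - (mz p.2 i)%:Z)) +
    (total_shift i)%:Z -
    \sum_(e < n * m) (mz (s e) i)%:Z * (x (clam n m e) 0 + (n * m - e.+1)%N%:Z).
  rewrite /zeta; congr (_ + _ - _).
    by rewrite mxE; congr (_ + _); rewrite /pvec mxE [X in _ + X]mxE !vecE.
  by apply: eq_bigr => e _; rewrite [(x + _) _ _]mxE pvec_clam addr0.
by rewrite /zeta; ring.
Qed.

(** * Division by the binomials of independent directions *)

Definition basis_index := [seq inl k | k <- iota 1 n.-1] ++ [seq inr l | l <- iota 1 m.-1]
  : seq (nat + nat).

(** Adding [x_0 - x_k] lowers entry [k] by 1 and otherwise changes only entry 0. The entries of
    positive index are therefore integral coordinates for the basis, without denominators. *)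
Definition basis_coord s (j : nat + nat) (x : space) : int :=
  match j with
  | inl k => if insub k is Some i then zeta s (lshift m i) x else 0
  | inr l => if insub l is Some i then zeta s (rshift n i) x else 0
  end.

Definition basis_vec (j : nat + nat) : space :=
  match j with inl k => pvec (1, k * m + 1)%N | inr l => pvec (m, m + l)%N end.

Lemma basis_vecE : [seq basis_vec j | j <- basis_index] =
  [seq pvec t | t <- xbasis n m ++ ybasis m].
Proof. by rewrite !map_cat -!map_comp. Qed.

Lemma basis_index_l k : (inl k \in basis_index) = (0 < k < n)%N.
Proof.
rewrite mem_cat (mem_map (@inl_inj _ _)) mem_iota.
have -> : (inl k \in [seq @inr nat nat l | l <- iota 1 m.-1]) = false.
  by apply/negbTE/negP => /mapP[].
by rewrite orbF; lia.
Qed.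

Lemma basis_index_r l : (inr l \in basis_index) = (0 < l < m)%N.
Proof.
rewrite mem_cat (mem_map (@inr_inj _ _)) mem_iota.
have -> : (inr l \in [seq @inl nat nat k | k <- iota 1 n.-1]) = false.
  by apply/negbTE/negP => /mapP[].
by rewrite /=; lia.
Qed.

Lemma basis_index_uniq : uniq basis_index.
Proof.
rewrite cat_uniq !map_inj_uniq ?iota_uniq ?andbT /=; [|exact: inr_inj|exact: inl_inj].
by apply/hasPn => j /mapP[l _ ->]; apply/negP => /mapP[].
Qed.

Lemma zeta_basis_l s i x k : (0 < k < n)%N -> zeta s i (x + basis_vec (inl k)) =
  zeta s i x + (if split i is inl a then (0 == a :> nat)%N%:Z - (k == a :> nat)%N%:Z else 0).
Proof.
move=> kn; rewrite zeta_pvec /=; congr (_ + _).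
have E1 : (1 %/ m = 0)%N by rewrite divn_small.
have E2 : ((k * m + 1) %/ m = k)%N by rewrite divnMDl ?E1 ?addn0 //; lia.
case: split_ordP => a ->; first by rewrite !mz_l E1 E2.
by rewrite !mz_r modnMDl subrr.
Qed.

Lemma zeta_basis_r s i x l : (0 < l < m)%N -> zeta s i (x + basis_vec (inr l)) =
  zeta s i x + (if split i is inr a then (0 == a :> nat)%N%:Z - (l == a :> nat)%N%:Z else 0).
Proof.
move=> lm; rewrite zeta_pvec /=; congr (_ + _).
have m0 : (0 < m)%N by lia.
have E1 : ((m + l) %/ m = 1)%N by rewrite divnDl // divnn m0 divn_small //; lia.
have E2 : ((m + l) %% m = l)%N by rewrite modnDl modn_small //; lia.
case: split_ordP => a ->; first by rewrite !mz_l E1 divnn m0 subrr.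
by rewrite !mz_r E2 modnn.
Qed.

Lemma split_l (i : 'I_n) : split (lshift m i) = inl i. Proof. exact: (unsplitK (inl _ i)). Qed.
Lemma split_r (i : 'I_m) : split (rshift n i) = inr i. Proof. exact: (unsplitK (inr _ i)). Qed.

Lemma basis_coordE s : {in basis_index &, forall i j x,
  basis_coord s i (x + basis_vec j) = basis_coord s i x - (i == j)%:Z}.
Proof.
move=> [k|k] [l|l]; rewrite ?basis_index_l ?basis_index_r => Hk Hl x /=.
- case: insubP => [a _ ak|]; last by move=> /negP[]; lia.
  by rewrite zeta_basis_l // split_l ak -[inl k == _]/(k == l); lia.
- by case: insubP => [a _ ak|_]; rewrite ?zeta_basis_r // ?split_l ?addr0 //; apply/esym/subr0.
- by case: insubP => [a _ ak|_]; rewrite ?zeta_basis_l // ?split_r ?addr0 //; apply/esym/subr0.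
- case: insubP => [a _ ak|]; last by move=> /negP[]; lia.
  by rewrite zeta_basis_r // split_r ak -[inr k == _]/(k == l); lia.
Qed.

(** The integral span of the basis: differences of variables preserve both sums, and the sums
    determine the two entries of index 0 from the others. *)
Definition balanced s (x : space) : bool :=
  (\sum_(i < n) zeta s (lshift m i) x == 0) && (\sum_(j < m) zeta s (rshift n j) x == 0).

Lemma balanced_basis s : {in basis_index, forall j x,
  balanced s (x + basis_vec j) = balanced s x}.
Proof.
move=> [k|l]; rewrite ?basis_index_l ?basis_index_r => Hk x; rewrite /balanced.
  congr (_ && _).
    rewrite (eq_bigr _ (fun i _ => zeta_basis_l s (lshift m i) x Hk)).
    under eq_bigr => i _ do rewrite split_l.
    rewrite big_split /= [X in _ + X == _]sumrB.
    have D a : (a < n)%N -> \sum_(i < n) (a == i :> nat)%N%:Z = 1.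
      by move=> an; rewrite -[RHS](@sum_delta n a (fun=> 1) an); apply: eq_bigr => i _; rewrite mul1r.
    by rewrite !D ?subrr ?addr0 //; lia.
  rewrite (eq_bigr _ (fun i _ => zeta_basis_l s (rshift n i) x Hk)).
  by under eq_bigr => i _ do rewrite split_r addr0.
congr (_ && _).
  rewrite (eq_bigr _ (fun i _ => zeta_basis_r s (lshift m i) x Hk)).
  by under eq_bigr => i _ do rewrite split_l addr0.
rewrite (eq_bigr _ (fun i _ => zeta_basis_r s (rshift n i) x Hk)).
under eq_bigr => i _ do rewrite split_r.
rewrite big_split /= [X in _ + X == _]sumrB.
have D a : (a < m)%N -> \sum_(i < m) (a == i :> nat)%N%:Z = 1.
  by move=> am; rewrite -[RHS](@sum_delta m a (fun=> 1) am); apply: eq_bigr => i _; rewrite mul1r.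
by rewrite !D ?subrr ?addr0 //; lia.
Qed.

Lemma balanced_zeta0 s x :
  balanced s x && all (fun j => basis_coord s j x == 0) basis_index =
  [forall i, zeta s i x == 0].
Proof.
apply/andP/forallP => [[/andP[/eqP bx /eqP yb] /allP H] i|H].
  have Hx (a : 'I_n) : (0 < a)%N -> zeta s (lshift m a) x = 0.
    move=> a0; have := H (inl (val a)); rewrite basis_index_l a0 ltn_ord => /(_ isT).
    by rewrite /= valK => /eqP.
  have Hy (a : 'I_m) : (0 < a)%N -> zeta s (rshift n a) x = 0.
    move=> a0; have := H (inr (val a)); rewrite basis_index_r a0 ltn_ord => /(_ isT).
    by rewrite /= valK => /eqP.
  case: (split_ordP i) => a ->; case: (posnP a) => a0.
  - move: bx; rewrite (bigD1 a) //= big1 ?addr0 => [->//|b ba]; apply: Hx.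
    by rewrite lt0n -a0; apply: contra ba => /eqP ba; apply/eqP/val_inj.
  - by rewrite Hx.
  - move: yb; rewrite (bigD1 a) //= big1 ?addr0 => [->//|b ba]; apply: Hy.
    by rewrite lt0n -a0; apply: contra ba => /eqP ba; apply/eqP/val_inj.
  - by rewrite Hy.
split.
  by apply/andP; split; rewrite big1 // => i _; apply/eqP.
by apply/allP => -[k|k] _ /=; case: insub.
Qed.

Definition orthant s (x : space) : bool :=
  balanced s x && all (fun j => 0 <= basis_coord s j x) basis_index.

Lemma polyhedral_orthant s : polyhedral (orthant s).
Proof.
apply: polyhedralI.
  by apply: polyhedralI; apply: polyhedral_eq0; apply: affine_sum => i; apply: affine_zeta.
apply: polyhedral_all => -[k|k] /=; apply: polyhedral_ge0; case: insub => [i|];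
  by [apply: affine_zeta | apply: affine_cst].
Qed.

(** The alternant of [lam] divided by the binomials of [xbasis] and [ybasis]: the monomial of each
    permutation spreads into the indicator of an orthant. *)
Definition orthant_sum (x : space) : rat :=
  \sum_(s : 'S_(n * m)) (-1) ^+ s * (good x && orthant s x)%:R.

Lemma pqpoly_orthant_sum : pqpoly 0 orthant_sum.
Proof.
apply: pqpoly_sum => s; apply: pqpoly_polyhedral.
exact: polyhedralI polyhedral_good (polyhedral_orthant s).
Qed.

Lemma good_translate (u x : space) : (forall e, u (clam n m e) 0 = 0) -> good (x + u) = good x.
Proof.
move=> u0; have E e : (x + u) (clam n m e) 0 = x (clam n m e) 0 by rewrite mxE u0 addr0.
congr (_ && _); apply: eq_forallb => e; rewrite E //.
by apply: eq_forallb => f; rewrite E.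
Qed.

Lemma diffs_orthant_sum x :
  diffs [seq pvec t | t <- xbasis n m ++ ybasis m] orthant_sum x =
  (good x)%:R * \sum_(s : 'S_(n * m)) (-1) ^+ s * ([forall i, zeta s i x == 0])%:R.
Proof.
rewrite diffs_sum mulr_sumr; apply: eq_bigr => s _; rewrite mulrCA; congr (_ * _).
rewrite (@eq_diffs _ _ _ (fun y => (good y)%:R * (orthant s y)%:R)); last first.
  by move=> y; rewrite -natrM mulnb.
rewrite diffs_invariantM => [|u /mapP[t _ ->] y]; last first.
  by rewrite good_translate // => e; apply: pvec_clam.
congr (_ * _); rewrite -basis_vecE -balanced_zeta0.
apply: (diffs_orthant basis_index_uniq (basis_coordE s) (@balanced_basis s)).
Qed.

Definition wbound : int := weight wtrow (vec total_shift).

(** The variables [x_0] and [y_0] have weight 0. The sign of their exponents is left free, because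
    [orthant] does not control it. *)
Lemma weight_ge0 (x : space) : (forall i : 'I_n, (0 < i)%N -> 0 <= x (cmu n m i) 0) ->
  (forall j : 'I_m, (0 < j)%N -> 0 <= x (cnu n m j) 0) -> 0 <= weight wtrow x.
Proof.
move=> Hx Hy; rewrite weightE addr_ge0 // sumr_ge0 // => i _.
  by case: (posnP i) => [->|/Hx i0]; rewrite ?muln0 ?mul0r // mulr_ge0.
by case: (posnP i) => [->|/Hy i0]; rewrite ?mul0r // mulr_ge0.
Qed.

Lemma wbound_ge0 : 0 <= wbound.
Proof. by apply: weight_ge0 => i _; rewrite (cmuE, cnuE) vecE. Qed.

Lemma orthant_sum_bounded : bounded_below wtrow wbound orthant_sum.
Proof.
move=> x xb; rewrite /orthant_sum big1 // => s _.
case: andP => [[/andP[/forallP x0 _] /andP[_ /allP H]]|_]; last by rewrite mulr0.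
suff : 0 <= weight wtrow (x + vec total_shift).
  by rewrite weightD -/wbound; move: xb; set v := weight _ _; lia.
(* After translation by [total_shift], the exponent is [zeta] plus the exponent of a monomial of the
   alternant, which is nonnegative; this explains the choice of [wbound]. *)
have xz i : (x + vec total_shift) (wpos i) 0 = zeta s i x +
    \sum_(e < n * m) (mz (s e) i)%:Z * (x (clam n m e) 0 + (n * m - e.+1)%N%:Z).
  by rewrite mxE vecE /zeta subrK.
have T0 i : 0 <= \sum_(e < n * m) (mz (s e) i)%:Z * (x (clam n m e) 0 + (n * m - e.+1)%N%:Z).
  by apply: sumr_ge0 => e _; rewrite mulr_ge0 // addr_ge0.
apply: weight_ge0 => a a0; rewrite (cmuE, cnuE) xz addr_ge0 //.
  have := H (inl (val a)); rewrite basis_index_l a0 ltn_ord => /(_ isT).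
  by rewrite /= valK.
have := H (inr (val a)); rewrite basis_index_r a0 ltn_ord => /(_ isT).
by rewrite /= valK.
Qed.

Variable g : {ffun 'I_n -> nat} -> {ffun 'I_m -> nat} -> {ffun 'I_(n * m) -> nat} -> rat.
Hypothesis hg : is_kronecker g.

Lemma diffs_coef_kron_poly (lam : {ffun 'I_(n * m) -> nat}) x : is_partition lam ->
  diffs [seq pvec t | t <- factor_pairs] (wcoef (kron_poly g lam)) x =
  wcoef (alternant (fun e => 'X_[mz e]) (n * m) (shifted (n * m) (extend0 lam)))
    (x + vec total_shift).
Proof.
move=> part; rewrite -wcoef_binomials -(kron_polyE hg hn hm part).
rewrite /xv /yv !mpolyXn -mpolyXD -mulrA vecD addrA wcoefMX.
by [].
Qed.

Definition kron_coef (x : space) : rat := (good x)%:R * wcoef (kron_poly g (lam_of x)) x.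

Lemma diffs_kron_coef x : diffs [seq pvec t | t <- factor_pairs] kron_coef x =
  (good x)%:R * \sum_(s : 'S_(n * m)) (-1) ^+ s * ([forall i, zeta s i x == 0])%:R.
Proof.
(* The directions fix the coordinates of [lam], so along them [kron_coef] reads the coefficients of
   one fixed polynomial. *)
pose Q (y : space) := forall e, y (clam n m e) 0 = x (clam n m e) 0.
rewrite (@eq_diffs_on _ Q _ _ (fun y => (good x)%:R * wcoef (kron_poly g (lam_of x)) y)) //.
- rewrite (diffs_invariantM (b := fun=> (good x)%:R)) //.
  case: (boolP (good x)) => gx; last by rewrite !mul0r.
  rewrite !mul1r diffs_coef_kron_poly ?good_partition // wcoef_alternant.
  apply: eq_bigr => s _; congr (_ * (nat_of_bool _)%:R); apply: eq_forallb => i.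
  rewrite mxE vecE /zeta subr_eq0; congr (_ == _).
  rewrite (big_morph Posz PoszD (erefl 0%:Z)); apply: eq_bigr => e _.
  rewrite PoszM; congr (_ * _); rewrite /shifted PoszD extend0E ffunE gez0_abs //.
  by case/andP: gx => /forallP.
- by move=> u /mapP[t _ ->] y Qy e; rewrite mxE pvec_clam addr0.
- move=> y Qy; congr (_%:R * wcoef (kron_poly g _) _).
    have -> : y = x + (y - x) by rewrite addrC subrK.
    by rewrite good_translate // => e; rewrite !mxE Qy subrr.
  by apply/ffunP => e; rewrite !ffunE Qy.
Qed.

Lemma kron_coef_bounded : bounded_below wtrow wbound kron_coef.
Proof.
by move=> x xb; rewrite /kron_coef (wcoef_bounded _ wbound_ge0 xb) mulr0.
Qed.

(** The line sums of [orthant_sum] along the remaining directions and [kron_coef] have equal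
    differences along all factor pairs and lie in the same class of bounded below functions, so they
    coincide. *)
Lemma pqpoly_kron_coef : pqpoly (size (other_pairs n m)) kron_coef.
Proof.
have sub : {subset rev (other_pairs n m) <= pairs (n * m)}.
  move=> p; rewrite mem_rev => pi; apply: factor_pairs_sub.
  by rewrite !mem_cat pi !orbT.
have [p1 b1 E] := line_sumsP (pvec_descending sub) orthant_sum_bounded pqpoly_orthant_sum.
rewrite map_rev in p1 b1 E; rewrite size_rev size_map addn0 in p1; rewrite revK in E.
apply: pqpoly_ext p1; apply: (diffs_inj (pvec_descending factor_pairs_sub) b1 kron_coef_bounded).
move=> x; rewrite diffs_kron_coef -diffs_orthant_sum /factor_pairs catA map_cat diffs_cat.
by apply: eq_diffs => y; rewrite E.
Qed.

(** * Extraction of one Kronecker coefficient *)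

Lemma alternant_xvE (l : nat -> nat) : alternant (xv n m) n l =
  \sum_(s : 'S_n) (-1) ^+ s *: 'X_[(\sum_(j < n) ux n m (s j) *+ l j)%MM].
Proof.
apply: eq_bigr => s _; rewrite -mpolyX_bigprod scaler_sign mulr_sign.
by congr (if _ then - _ else _); apply: eq_bigr => e _; rewrite mxE mpolyXn.
Qed.

Lemma alternant_yvE (l : nat -> nat) : alternant (yv n m) m l =
  \sum_(s : 'S_m) (-1) ^+ s *: 'X_[(\sum_(j < m) uy n m (s j) *+ l j)%MM].
Proof.
apply: eq_bigr => s _; rewrite -mpolyX_bigprod scaler_sign mulr_sign.
by congr (if _ then - _ else _); apply: eq_bigr => e _; rewrite mxE mpolyXn.
Qed.

Lemma sum_perm_delta k (s : 'S_k) (l : nat -> nat) (i : 'I_k) :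
  (\sum_(j < k) (s j == s i :> nat) * l j = l i)%N.
Proof.
rewrite (bigD1 i) //= eqxx mul1n big1 ?addn0 // => j ji.
have -> : (s j == s i :> nat) = false; last by rewrite mul0n.
by apply/negbTE; apply: contra ji => /eqP/val_inj/perm_inj ->.
Qed.

Lemma mcoeff_alternants (mu mu' : 'I_n -> nat) (nu nu' : 'I_m -> nat) (w : mono) :
  is_partition mu -> is_partition mu' -> is_partition nu -> is_partition nu' ->
  (forall i, w (lshift m i) = shifted n (extend0 mu) i) ->
  (forall j, w (rshift n j) = shifted m (extend0 nu) j) ->
  (alternant (xv n m) n (shifted n (extend0 mu')) *
   alternant (yv n m) m (shifted m (extend0 nu')))@_w =
  ([forall i, mu' i == mu i] && [forall j, nu' j == nu j])%:R.
Proof.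
move=> pmu pmu' pnu pnu' wx wy; rewrite alternant_xvE alternant_yvE big_distrlr raddf_sum /=.
set lx := shifted n (extend0 mu'); set ly := shifted m (extend0 nu').
(* The exponents of [w] strictly decrease within each group of variables, so only the term with both
   permutations trivial can reach it. *)
have key (s : 'S_n) (t : 'S_m) :
    ((\sum_(j < n) ux n m (s j) *+ lx j + \sum_(j < m) uy n m (t j) *+ ly j)%MM == w) =
    [&& s == 1%g, t == 1%g, [forall i, mu' i == mu i] & [forall j, nu' j == nu j]].
  set W := (_ + _)%MM.
  have Wx (i : 'I_n) : W (lshift m (s i)) = lx i.
    rewrite mnmDE !mnm_sumE [X in (_ + X)%N]big1 ?addn0 => [|j _]; last first.
      by rewrite mulmnE uy_l.
    rewrite -[RHS](sum_perm_delta s lx i); apply: eq_bigr => j _.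
    by rewrite mulmnE uxE.
  have Wy (i : 'I_m) : W (rshift n (t i)) = ly i.
    rewrite mnmDE !mnm_sumE [X in (X + _)%N]big1 ?add0n => [|j _]; last first.
      by rewrite mulmnE ux_r.
    rewrite -[RHS](sum_perm_delta t ly i); apply: eq_bigr => j _.
    by rewrite mulmnE uyE.
  apply/eqP/and4P => [E|[/eqP s1 /eqP t1 /forallP Emu /forallP Enu]].
    have Ex (j : 'I_n) : lx j = shifted n (extend0 mu) (s j) by rewrite -Wx E wx.
    have Ey (j : 'I_m) : ly j = shifted m (extend0 nu) (t j) by rewrite -Wy E wy.
    have [s1 El] := decreasing_perm_eq (shifted_decreasing pmu') (shifted_decreasing pmu) Ex.
    have [t1 El'] := decreasing_perm_eq (shifted_decreasing pnu') (shifted_decreasing pnu) Ey.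
    split; rewrite ?s1 ?t1 //; apply/forallP => i; apply/eqP.
      by have := El i; rewrite /shifted !extend0E => /addIn.
    by have := El' i; rewrite /shifted !extend0E => /addIn.
  apply/mnmP => i; case: (split_ordP i) => a ->.
    rewrite -[in LHS](permKV s a) Wx wx /lx s1 invg1 perm1 /shifted !extend0E.
    by rewrite (eqP (Emu a)).
  rewrite -[in LHS](permKV t a) Wy wy /ly t1 invg1 perm1 /shifted !extend0E.
  by rewrite (eqP (Enu a)).
rewrite (bigD1 1%g) //= [X in _ + X]big1 ?addr0 => [|s s1]; last first.
  rewrite raddf_sum big1 //= => t _.
  by rewrite -scalerAl -scalerAr -mpolyXD !mcoeffZ mcoeffX key (negbTE s1) !mulr0.
rewrite raddf_sum (bigD1 1%g) //= [X in _ + X]big1 ?addr0 => [|t t1]; last first.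
  by rewrite -scalerAl -scalerAr -mpolyXD !mcoeffZ mcoeffX key (negbTE t1) andbF !mulr0.
by rewrite -scalerAl -scalerAr -mpolyXD !mcoeffZ mcoeffX key !eqxx !odd_perm1 !expr0 !mul1r.
Qed.

Definition staircase : mono :=
  [multinom (match split i with inl a => n - a.+1 | inr b => m - b.+1 end)%N | i < n + m].

Lemma staircase_l i : staircase (lshift m i) = (n - i.+1)%N.
Proof. by rewrite mnmE split_l. Qed.

Lemma staircase_r j : staircase (rshift n j) = (m - j.+1)%N.
Proof. by rewrite mnmE split_r. Qed.

Lemma psize_ge K (mu : 'I_K -> nat) i : (mu i <= psize mu)%N.
Proof. by rewrite /psize (bigD1 i) //= leq_addr. Qed.

(** Adding [staircase] turns [mu] and [nu] into [mu + delta] and [nu + delta], the exponent that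
    occurs in exactly one product of alternants. *)
Lemma kron_fun_coef x : kron_domain n m x -> kron_fun g x = kron_coef (x + vec staircase).
Proof.
case=> x0 [pmu [pnu [plam [smu snu]]]].
have lamE : lam_of (x + vec staircase) = [ffun k => `|x (clam n m k) ord0|%N].
  by apply/ffunP => e; rewrite !ffunE mxE vec_clam addr0.
rewrite /kron_coef lamE good_translate; last by move=> e; apply: vec_clam.
set lam := [ffun k => _].
have -> : good x.
  apply/andP; split; first by apply/forallP.
  apply/forallP => e; apply/forallP => f; apply/implyP => ef.
  have /forallP/(_ e)/forallP/(_ f)/implyP/(_ ef) := plam.
  have := x0 (clam n m e); have := x0 (clam n m f).
  by move: (x (clam n m e) 0) (x (clam n m f) 0) => a b; lia.
rewrite mul1r /wcoef; case: ifP => [_|/negP[]]; last first.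
  by apply/forallP => i; rewrite mxE vecE addr_ge0.
set w := wexp _.
pose mu0 i := `|x (cmu n m i) ord0|%N; pose nu0 j := `|x (cnu n m j) ord0|%N.
have wx i : w (lshift m i) = shifted n (extend0 mu0) i.
  rewrite mnmE mxE vecE staircase_l /shifted extend0E /mu0 -/(cmu n m i).
  by have := x0 (cmu n m i); move: (x (cmu n m i) 0) => v; lia.
have wy j : w (rshift n j) = shifted m (extend0 nu0) j.
  rewrite mnmE mxE vecE staircase_r /shifted extend0E /nu0 -/(cnu n m j).
  by have := x0 (cnu n m j); move: (x (cnu n m j) 0) => v; lia.
have psl : psize lam = psize (fun k => `|x (clam n m k) ord0|%N).
  by apply: eq_bigr => k _; rewrite ffunE.
(* The sums in [kron_poly] run over parts of size at most [psize lam]; the equality of sizes in the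
   domain places [mu] and [nu] in this range. *)
have mub i : (mu0 i < (psize lam).+1)%N by rewrite ltnS psl -smu; apply: psize_ge.
have nub j : (nu0 j < (psize lam).+1)%N by rewrite ltnS psl -snu; apply: psize_ge.
pose mu1 : {ffun 'I_n -> 'I_(psize lam).+1} := [ffun i => Ordinal (mub i)].
pose nu1 : {ffun 'I_m -> 'I_(psize lam).+1} := [ffun j => Ordinal (nub j)].
have pn1 : is_pn mu1.
  apply/andP; split.
    apply/forallP => i; apply/forallP => j; rewrite !ffunE.
    by have /forallP/(_ i)/forallP/(_ j) := pmu.
  apply/eqP/(etrans _ (etrans smu (esym psl))).
  by apply: eq_bigr => i _; rewrite ffunE.
have pn2 : is_pn nu1.
  apply/andP; split.
    apply/forallP => i; apply/forallP => j; rewrite !ffunE.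
    by have /forallP/(_ i)/forallP/(_ j) := pnu.
  apply/eqP/(etrans _ (etrans snu (esym psl))).
  by apply: eq_bigr => i _; rewrite ffunE.
rewrite /kron_poly raddf_sum (bigD1 mu1) //= [X in _ + X]big1 ?addr0; last first.
  move=> mu /andP[/andP[pm _] mu_ne]; rewrite raddf_sum big1 // => nu /andP[pn _] /=.
  rewrite mcoeffZ (mcoeff_alternants pmu pm pnu pn wx wy).
  case: forallP => [E|_]; last by rewrite mulr0.
  case/eqP: mu_ne; apply/ffunP => i; apply: val_inj; rewrite !ffunE; exact/eqP.
rewrite raddf_sum (bigD1 nu1) //= [X in _ + X]big1 ?addr0; last first.
  move=> nu /andP[/andP[pn _] nu_ne] /=; have /andP[pm _] := pn1.
  rewrite mcoeffZ (mcoeff_alternants pmu pm pnu pn wx wy) andbC.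
  case: forallP => [E|_]; last by rewrite mulr0.
  case/eqP: nu_ne; apply/ffunP => i; apply: val_inj; rewrite !ffunE; exact/eqP.
have /andP[pm _] := pn1; have /andP[pn _] := pn2.
rewrite mcoeffZ (mcoeff_alternants pmu pm pnu pn wx wy).
have -> : [forall i, val (mu1 i) == mu0 i] by apply/forallP => i; rewrite ffunE.
have -> : [forall j, val (nu1 j) == nu0 j] by apply/forallP => j; rewrite ffunE.
rewrite mulr1 /kron_fun; congr g; apply/ffunP => i; by rewrite !ffunE.
Qed.

End KroneckerFunction.

Theorem theorem4p3 (n m : nat) (hn : (2 <= n)%N) (hm : (2 <= m)%N)
    (g : {ffun 'I_n -> nat} -> {ffun 'I_m -> nat} -> {ffun 'I_(n * m) -> nat} -> rat)
    (hg : is_kronecker g) :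
  piecewise_quasipoly_deg_le (kron_domain n m) (kron_fun g)
    ('C(n * m, 2) - 'C(n, 2) - 'C(m, 2) - (n + m - 2))%N.
Proof.
rewrite -size_other_pairs //.
apply: (pqpoly_piecewise (pqpoly_translate (vec (staircase n m)) (pqpoly_kron_coef hn hm hg))).
exact: kron_fun_coef.
Qed.
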